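(* Let $L/K$ be a field extension of odd degree with $\mathrm{char}\,K\neq 2$. Let $\mathscr{C}$ be an additive $K$-category such that $\dim_K\mathrm{Hom}(X,Y)$ is finite for all $X,Y\in\mathscr{C}$. Let $\{( *_i,\omega_i)\}_{i\in I}$ be a nonempty family of $K$-linear hermitian structures on $\mathscr{C}$ and let $(M,\{s_i\})$, $(M',\{s'_i\})$ be two systems of sesquilinear forms over $(\mathscr{C},\{*_i,\omega_i\}_{i\in I})$. Then $\mathcal{R}_{L/K}(M,\{s_i\})\simeq\mathcal{R}_{L/K}(M',\{s'_i\})$ if and only if $(M,\{s_i\})\simeq(M',\{s'_i\})$, where $\simeq$ denotes isometry.
   Context: A $K$-category is an additive category whose Hom-sets are $K$-modules with $K$-bilinear composition. A hermitian structure on an additive category $\mathscr{C}$ is a pair $( *,\omega)$ with $*:\mathscr{C}\to\mathscr{C}$ an (additive) contravariant functor and $\omega:\mathrm{id}\to **$ a natural transformation (not necessarily an isomorphism) with $\omega_C^*\,\omega_{C^*}=\mathrm{id}_{C^*}$ for all $C$; it is $K$-linear if $*$ is $K$-linear on Hom-modules. A system of sesquilinear forms over $(\mathscr{C},\{*_i,\omega_i\}_{i\in I})$ is a pair $(M,\{s_i\}_{i\in I})$ with $M\in\mathscr{C}$ and $s_i:M\to M^{*_i}$ any morphism for each $i$. An isometry $(M,\{s_i\})\to(M',\{s_i'\})$ is an isomorphism $f:M\to M'$ with $f^{*_i}s_i'f=s_i$ for all $i\in I$. Scalar extension: $\mathscr{C}_L=\mathscr{C}\otimes_K L$ is the category with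 objects formal symbols $C_L$ ($C\in\mathscr{C}$), with $\mathrm{Hom}_{\mathscr{C}_L}(A_L,B_L)=\mathrm{Hom}_{\mathscr{C}}(A,B)\otimes_K L$ and the obvious composition. Each $( *_i,\omega_i)$ induces a hermitian structure on $\mathscr{C}_L$ by $(C_L)^{*_i}=(C^{*_i})_L$, $(f\otimes a)^{*_i}=f^{*_i}\otimes a$, $\omega_{i,C_L}=\omega_{i,C}\otimes 1$. $\mathcal{R}_{L/K}$ sends a system $(M,\{s_i\})$ over $\mathscr{C}$ to the system $(M_L,\{s_i\otimes 1\})$ over $\mathscr{C}_L$. *)

(* Defs.v *)
From HB Require Import structures.
From mathcomp Require Import all_boot all_order all_algebra all_field.
From mathcomp Require Import boolp.

Set Implicit Arguments.
Unset Strict Implicit.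
Unset Printing Implicit Defensive.

Import GRing.Theory.
Local Open Scope ring_scope.
Local Open Scope quotient_scope.

(* [tensor V W] is V (x)_K W: formal sums [:: (v_1, w_1); ...; (v_n, w_n)] of  *)
(* pure tensors, where two sums are identified as soon as no K-bilinear map    *)
(* separates them.  The universal property is [tensor_universal].              *)
Section TensorProduct.
Variables (K : comNzRingType) (V W : lmodType K).
Implicit Types (s t : seq (V * W)).

Definition bisum (U : zmodType) (b : V -> W -> U) s : U :=
  \sum_(p <- s) b p.1 p.2.

Definition tensor_eq : rel (seq (V * W)) := fun s t =>
  `[< forall (U : lmodType K) (b : V -> W -> U),
        bilinear_for *:%R *:%R b -> bisum b s = bisum b t >].

Fact tensor_eq_refl : reflexive tensor_eq.
Proof. by move=> s; apply/asboolP. Qed.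

Fact tensor_eq_sym : symmetric tensor_eq.
Proof.
by move=> s t; apply/asboolP/asboolP => st U b /st ->.
Qed.

Fact tensor_eq_trans : transitive tensor_eq.
Proof.
move=> t s u /asboolP st /asboolP tu; apply/asboolP => U b bilb.
by rewrite st // tu.
Qed.

Canonical tensor_equiv :=
  EquivRel tensor_eq tensor_eq_refl tensor_eq_sym tensor_eq_trans.

Definition tensor : Type := {eq_quot tensor_equiv}.
HB.instance Definition _ := Choice.on tensor.

Implicit Types x y z : tensor.

Definition tclass s : tensor := \pi_({eq_quot tensor_equiv}) s.
Definition trepr x : seq (V * W) := repr (x : {eq_quot tensor_equiv}).

Definition tens (v : V) (w : W) : tensor := tclass [:: (v, w)].

(* The linear map induced by b on V (x) W; only meaningful for bilinear b.     *)
Definition tlift (U : zmodType) (b : V -> W -> U) x : U := bisum b (trepr x).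

Lemma treprK x : tclass (trepr x) = x.
Proof. exact: reprK. Qed.

Lemma tclassP s t :
  (forall (U : lmodType K) (b : V -> W -> U),
     bilinear_for *:%R *:%R b -> bisum b s = bisum b t) ->
  tclass s = tclass t.
Proof. by move=> st; apply/eqmodP/asboolP. Qed.

Lemma tlift_class (U : lmodType K) (b : V -> W -> U) s :
  bilinear_for *:%R *:%R b -> tlift b (tclass s) = bisum b s.
Proof.
move=> bilb; rewrite /tlift.
have /eqmodP/asboolP : tclass (trepr (tclass s)) = tclass s by rewrite treprK.
by apply.
Qed.

Lemma tensor_eqP x y :
  (forall (U : lmodType K) (b : V -> W -> U),
     bilinear_for *:%R *:%R b -> tlift b x = tlift b y) -> x = y.
Proof. by move=> xy; rewrite -[x]treprK -[y]treprK; apply: tclassP. Qed.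

Definition tadd x y : tensor := tclass (trepr x ++ trepr y).
Definition tscale (a : K) x : tensor :=
  tclass [seq (a *: p.1, p.2) | p <- trepr x].
Definition topp x : tensor := tscale (-1) x.
Definition tzero : tensor := tclass [::].

Section Lift.
Variables (U : lmodType K) (b : V -> W -> U).
Hypothesis bilb : bilinear_for *:%R *:%R b.

Let tlift_add x y : tlift b (tadd x y) = tlift b x + tlift b y.
Proof. by rewrite tlift_class // /bisum big_cat. Qed.

Let tlift_scale a x : tlift b (tscale a x) = a *: tlift b x.
Proof.
rewrite tlift_class // /tlift /bisum big_map scaler_sumr.
by apply: eq_bigr => p _; apply: (scalable_linear (bilb.1 p.2)).
Qed.

Let tlift_opp x : tlift b (topp x) = - tlift b x.
Proof. by rewrite tlift_scale scaleN1r. Qed.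

Let tlift_zero : tlift b tzero = 0.
Proof. by rewrite tlift_class // /bisum big_nil. Qed.

Definition tliftE := (tlift_add, tlift_scale, tlift_opp, tlift_zero).
End Lift.

Fact taddA : associative tadd.
Proof. by move=> x y z; apply: tensor_eqP => U b B; rewrite !tliftE // addrA. Qed.

Fact taddC : commutative tadd.
Proof. by move=> x y; apply: tensor_eqP => U b B; rewrite !tliftE // addrC. Qed.

Fact tadd0 : left_id tzero tadd.
Proof. by move=> x; apply: tensor_eqP => U b B; rewrite !tliftE // add0r. Qed.

Fact taddN : left_inverse tzero topp tadd.
Proof. by move=> x; apply: tensor_eqP => U b B; rewrite !tliftE // addNr. Qed.

HB.instance Definition _ := GRing.isZmodule.Build tensor taddA taddC tadd0 taddN.

Fact tscaleA a c x : tscale a (tscale c x) = tscale (a * c) x.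
Proof. by apply: tensor_eqP => U b B; rewrite !tliftE // scalerA. Qed.

Fact tscale1 : left_id 1 tscale.
Proof. by move=> x; apply: tensor_eqP => U b B; rewrite !tliftE // scale1r. Qed.

Fact tscaleDr : right_distributive tscale +%R.
Proof. by move=> a x y; apply: tensor_eqP => U b B; rewrite !tliftE // scalerDr. Qed.

Fact tscaleDl x : {morph tscale^~ x : a c / a + c}.
Proof. by move=> a c; apply: tensor_eqP => U b B; rewrite !tliftE // scalerDl. Qed.

HB.instance Definition _ :=
  GRing.Zmodule_isLmodule.Build K tensor tscaleA tscale1 tscaleDr tscaleDl.

Lemma tlift_tens (U : lmodType K) (b : V -> W -> U) v w :
  bilinear_for *:%R *:%R b -> tlift b (tens v w) = b v w.
Proof. by move=> B; rewrite tlift_class // /bisum big_seq1. Qed.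

Lemma tlift_linear (U : lmodType K) (b : V -> W -> U) :
  bilinear_for *:%R *:%R b -> linear (tlift b).
Proof. by move=> B a x y; rewrite -(tliftE B) -(tliftE B). Qed.

Lemma tens_bilinear : bilinear_for *:%R *:%R tens.
Proof.
split=> [w | v] a x y; apply: tensor_eqP => U b B;
  rewrite (tlift_linear B) !tlift_tens //; [exact: B.1 | exact: B.2].
Qed.

Lemma tensorE x : x = \sum_(p <- trepr x) tens p.1 p.2.
Proof.
rewrite -[in LHS](treprK x); elim: (trepr x) => [|p s IHs]; first by rewrite big_nil.
rewrite big_cons -IHs; apply: tensor_eqP => U b B.
rewrite (tliftE B) tlift_tens // !tlift_class //.
by rewrite /bisum big_cons.
Qed.

Lemma tensor_ind (P : tensor -> Prop) :
  P 0 -> (forall x y, P x -> P y -> P (x + y)) ->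
  (forall v w, P (tens v w)) -> forall x, P x.
Proof. by move=> P0 PD Pt x; rewrite [x]tensorE; elim/big_rec: _ => *; auto. Qed.

Theorem tensor_universal (U : lmodType K) (b : V -> W -> U) :
  bilinear_for *:%R *:%R b ->
  exists f : {linear tensor -> U},
    (forall v w, f (tens v w) = b v w) /\
    (forall g : {linear tensor -> U},
       (forall v w, g (tens v w) = b v w) -> g =1 f).
Proof.
move=> B.
pose M := GRing.isLinear.Build K tensor U *:%R (tlift b) (tlift_linear B).
have [f fE] : exists f : {linear tensor -> U}, f =1 tlift b.
  by exists (HB.pack (tlift b) M : {linear tensor -> U}).
have fT v w : f (tens v w) = b v w by rewrite fE tlift_tens.
exists f; split=> // g gE; apply: tensor_ind => [|x y gx gy|v w].
- by rewrite !raddf0.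
- by rewrite !raddfD /= gx gy.
- by rewrite gE fT.
Qed.

End TensorProduct.

Arguments tens {K V W} v w.
Arguments tlift {K V W U} b x.

(* V (x)_K L as an L-module; a separate name because it is convertible to the  *)
(* K-module [tensor V L], which carries a different scaling.                   *)
Definition ext (K : fieldType) (L : fieldExtType K) (V : lmodType K) : Type :=
  tensor V L.
HB.instance Definition _ (K : fieldType) (L : fieldExtType K) (V : lmodType K) :=
  GRing.Zmodule.on (ext L V).

Section ExtModule.
Variables (K : fieldType) (L : fieldExtType K) (V : lmodType K).
Local Notation VL := (ext L V).

Definition etens (v : V) (a : L) : VL := tens v a.

Lemma etens_bilinear :
  bilinear_for *:%R *:%R (etens : V -> L -> tensor V L).
Proof. exact: tens_bilinear. Qed.

Lemma etensDl v w a : etens (v + w) a = etens v a + etens w a.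
Proof. exact: (GRing.semilinear_linear (etens_bilinear.1 a)).2. Qed.

Lemma etensDr v a b : etens v (a + b) = etens v a + etens v b.
Proof. exact: (GRing.semilinear_linear (etens_bilinear.2 v)).2. Qed.

Lemma etensZ k v a : etens (k *: v) a = etens v (k *: a).
Proof.
rewrite [LHS](scalable_linear (etens_bilinear.1 a)).
by rewrite [RHS](scalable_linear (etens_bilinear.2 v)).
Qed.

Lemma etens0l a : etens 0 a = 0.
Proof. by apply: (addrI (etens 0 a)); rewrite -etensDl !addr0. Qed.

Lemma ext_ind (P : VL -> Prop) :
  P 0 -> (forall x y, P x -> P y -> P (x + y)) ->
  (forall v a, P (etens v a)) -> forall x, P x.
Proof. exact: tensor_ind. Qed.

Lemma ext_eq (U : zmodType) (f g : VL -> U) :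
  {morph f : x y / x + y} -> {morph g : x y / x + y} ->
  (forall v a, f (etens v a) = g (etens v a)) -> f =1 g.
Proof.
move=> fD gD fg; apply: ext_ind => // [|x y fx gy]; last by rewrite fD gD fx gy.
have h0 h : {morph h : x y / x + y :> VL >-> x + y :> U} -> h 0 = 0.
  by move=> hD; apply: (addrI (h 0)); rewrite -hD !addr0.
by rewrite (h0 f) ?(h0 g).
Qed.

Definition escale (c : L) (x : VL) : VL :=
  tlift (fun v a => tens v (c * a) : tensor V L) x.

Let escale_bil c :
  bilinear_for *:%R *:%R (fun v a => tens v (c * a) : tensor V L).
Proof.
split=> [a|v] k x y; first exact: (tens_bilinear V L).1.
by rewrite mulrDr -scalerAr; exact: (tens_bilinear V L).2.
Qed.

Lemma escale_tens c v a : escale c (etens v a) = etens v (c * a).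
Proof. exact: (tlift_tens _ _ (escale_bil c)). Qed.

Lemma escaleDr : right_distributive escale +%R.
Proof.
move=> c x y.
exact: (GRing.semilinear_linear (tlift_linear (escale_bil c))).2.
Qed.

Fact escaleA c d x : escale c (escale d x) = escale (c * d) x.
Proof.
move: x; apply: ext_eq => [x y|x y|v a]; rewrite ?escaleDr //.
by rewrite !escale_tens mulrA.
Qed.

Fact escale1 : left_id 1 escale.
Proof.
apply: ext_eq => [x y|x y|v a]; rewrite ?escaleDr //.
by rewrite escale_tens mul1r.
Qed.

Fact escaleDl x : {morph escale^~ x : c d / c + d}.
Proof.
move=> c d; move: x; apply: ext_eq => [x y|x y|v a].
- exact: escaleDr.
- by rewrite !escaleDr addrACA.
- by rewrite !escale_tens mulrDl etensDr.
Qed.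

HB.instance Definition _ :=
  GRing.Zmodule_isLmodule.Build L VL escaleA escale1 escaleDr escaleDl.

Lemma scale_etens c v a : c *: etens v a = etens v (c * a).
Proof. exact: escale_tens. Qed.

End ExtModule.

Arguments etens {K L V} v a.

Section ExtMaps.
Variables (K : fieldType) (L : fieldExtType K).

(* f (x) id_L, for linear f *)
Definition ext_map (V W : lmodType K) (f : V -> W) (x : ext L V) : ext L W :=
  tlift (fun v a => tens (f v) a : tensor W L) x.

(* (v (x) a, w (x) b) |-> m v w (x) ab, for bilinear m *)
Definition ext_map2 (V W U : lmodType K) (m : V -> W -> U)
    (x : ext L V) (y : ext L W) : ext L U :=
  tlift (fun v a => tlift (fun w b => tens (m v w) (a * b) : tensor U L) y) x.

Section Map.
Variables (V W : lmodType K) (f : V -> W).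
Hypothesis linf : linear f.

Let bil : bilinear_for *:%R *:%R (fun v a => tens (f v) a : tensor W L).
Proof.
split=> [a|v] k x y; last exact: (tens_bilinear W L).2.
by rewrite linf; exact: (tens_bilinear W L).1.
Qed.

Lemma ext_map_tens v a : ext_map f (etens v a) = etens (f v) a.
Proof. exact: (tlift_tens _ _ bil). Qed.

Lemma ext_mapD : {morph ext_map f : x y / x + y}.
Proof. exact: (GRing.semilinear_linear (tlift_linear bil)).2. Qed.

Lemma ext_map_linear : linear (ext_map f).
Proof.
move=> c x y; rewrite ext_mapD; congr (_ + _); move: x.
apply: ext_eq => [x z|x z|v a].
- by rewrite scalerDr ext_mapD.
- by rewrite ext_mapD scalerDr.
- by rewrite scale_etens !ext_map_tens scale_etens.
Qed.
End Map.

Section Map2.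
Variables (V W U : lmodType K) (m : V -> W -> U).
Hypothesis bilm : bilinear_for *:%R *:%R m.

Let bilr v a :
  bilinear_for *:%R *:%R (fun w b => tens (m v w) (a * b) : tensor U L).
Proof.
split=> [b|w] k x y; first by rewrite bilm.2; exact: (tens_bilinear U L).1.
by rewrite mulrDr -scalerAr; exact: (tens_bilinear U L).2.
Qed.

Let inner v a (y : ext L W) : tensor U L :=
  tlift (fun w b => tens (m v w) (a * b) : tensor U L) y.

Let innerD v a : {morph inner v a : x y / x + y}.
Proof. exact: (GRing.semilinear_linear (tlift_linear (bilr v a))).2. Qed.

Let inner_tens v a w b : inner v a (etens w b) = tens (m v w) (a * b).
Proof. exact: (tlift_tens _ _ (bilr v a)). Qed.

Let bill y : bilinear_for *:%R *:%R (fun v a => inner v a y).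
Proof.
split=> [a|v] k x z; move: y; apply: ext_eq => [y1 y2|y1 y2|w b].
- by rewrite innerD.
- by rewrite !innerD /= scalerDr addrACA.
- by rewrite !inner_tens bilm.1; exact: (tens_bilinear U L).1.
- by rewrite innerD.
- by rewrite !innerD /= scalerDr addrACA.
- by rewrite !inner_tens mulrDl -scalerAl; exact: (tens_bilinear U L).2.
Qed.

Lemma ext_map2_tens v a w b :
  ext_map2 m (etens v a) (etens w b) = etens (m v w) (a * b).
Proof. by rewrite [LHS](tlift_tens _ _ (bill _)); exact: inner_tens. Qed.

Lemma ext_map2Dl y : {morph (ext_map2 m)^~ y : x z / x + z}.
Proof. exact: (GRing.semilinear_linear (tlift_linear (bill y))).2. Qed.

Lemma ext_map2Dr x : {morph ext_map2 m x : y z / y + z}.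
Proof.
move=> y z; move: x; apply: ext_eq => [x1 x2|x1 x2|v a].
- by rewrite ext_map2Dl.
- by rewrite !ext_map2Dl addrACA.
- by rewrite ![ext_map2 _ _ _](tlift_tens _ _ (bill _)); exact: innerD.
Qed.

Lemma ext_map2_bilinear : bilinear_for *:%R *:%R (ext_map2 m).
Proof.
split=> [y|x] c /=.
  move=> x z; rewrite ext_map2Dl; congr (_ + _); move: x y.
  move=> x y; move: x; apply: ext_eq => [x1 x2|x1 x2|v a].
  - by rewrite scalerDr ext_map2Dl.
  - by rewrite ext_map2Dl scalerDr.
  move: y; apply: ext_eq => [y1 y2|y1 y2|w b].
  - by rewrite ext_map2Dr.
  - by rewrite ext_map2Dr scalerDr.
  - by rewrite scale_etens !ext_map2_tens scale_etens mulrA.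
move=> y z; rewrite ext_map2Dr; congr (_ + _).
move: y; apply: ext_eq => [y1 y2|y1 y2|w b].
- by rewrite scalerDr ext_map2Dr.
- by rewrite ext_map2Dr scalerDr.
move: x; apply: ext_eq => [x1 x2|x1 x2|v a].
- by rewrite ext_map2Dl.
- by rewrite ext_map2Dl scalerDr.
- by rewrite scale_etens !ext_map2_tens scale_etens mulrCA.
Qed.
End Map2.

End ExtMaps.

Record kcategory (K : comNzRingType) := KCategory {
  Ob :> Type;
  khom : Ob -> Ob -> lmodType K;
  kid : forall A, khom A A;
  kcomp : forall A B C, khom B C -> khom A B -> khom A C;
  kcompA : forall A B C D (h : khom C D) (g : khom B C) (f : khom A B),
    kcomp h (kcomp g f) = kcomp (kcomp h g) f;
  kcomp1m : forall A B (f : khom A B), kcomp (kid B) f = f;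
  kcompm1 : forall A B (f : khom A B), kcomp f (kid A) = f;
  kcomp_bilinear : forall A B C, bilinear_for *:%R *:%R (@kcomp A B C);
  zero_object : exists Z, forall A,
    (forall f : khom A Z, f = 0) /\ (forall f : khom Z A, f = 0);
  biproducts : forall A B, exists P,
    exists (i : khom A P) (j : khom B P) (p : khom P A) (q : khom P B),
      [/\ kcomp p i = kid A, kcomp q j = kid B, kcomp p j = 0, kcomp q i = 0 &
          kcomp i p + kcomp j q = kid P]
}.

Arguments khom {K k} A B.
Arguments kid {K k} A.
Arguments kcomp {K k A B C} g f.

Declare Scope kcat_scope.
Delimit Scope kcat_scope with kcat.
Local Open Scope kcat_scope.
Notation "g \oc f" := (kcomp g f) (at level 40, left associativity) : kcat_scope.

Definition is_isomorphism (K : comNzRingType) (C : kcategory K) (A B : C)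
    (f : khom A B) : Prop :=
  exists g : khom B A, g \oc f = kid A /\ f \oc g = kid B.

Record hermitian_structure (K : comNzRingType) (C : kcategory K) := Hermitian {
  hdual : C -> C;
  hdualm : forall A B : C, khom A B -> khom (hdual B) (hdual A);
  hdualm_id : forall A : C, hdualm (kid A) = kid (hdual A);
  hdualm_comp : forall (A B D : C) (g : khom B D) (f : khom A B),
    hdualm (g \oc f) = hdualm f \oc hdualm g;
  hdualm_linear : forall A B : C, linear (@hdualm A B);
  omega : forall A : C, khom A (hdual (hdual A));
  omega_natural : forall (A B : C) (f : khom A B),
    omega B \oc f = hdualm (hdualm f) \oc omega A;
  omega_dual : forall A : C, hdualm (omega A) \oc omega (hdual A) = kid (hdual A)
}.

Arguments hdual {K C} h A.
Arguments hdualm {K C} h {A B} f.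
Arguments omega {K C} h A.

Record sesq_system (K : comNzRingType) (C : kcategory K) (I : Type)
    (H : I -> hermitian_structure C) := SesqSystem {
  carrier : C;
  sform : forall i : I, khom carrier (hdual (H i) carrier)
}.

Definition isometric (K : comNzRingType) (C : kcategory K) (I : Type)
    (H : I -> hermitian_structure C) (S S' : sesq_system H) : Prop :=
  exists f : khom (carrier S) (carrier S'),
    is_isomorphism f /\
    forall i, hdualm (H i) f \oc sform S' i \oc f = sform S i.

Definition finite_dim (K : fieldType) (V : lmodType K) : Prop :=
  exists n : nat, inhabited (Vector.axiom n V).

Section CategoryExtension.
Variables (K : fieldType) (L : fieldExtType K) (C : kcategory K).
Implicit Types A B D E : C.

(* The object A of C also stands for the formal symbol A_L. *)
Local Notation HomL A B := (ext L (@khom K C A B)).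

Definition ext_comp A B D : HomL B D -> HomL A B -> HomL A D :=
  ext_map2 (@kcomp K C A B D).

Definition ext_id A : HomL A A := etens (kid A) 1.

Let ext_comp_tens A B D (g : khom B D) (f : khom A B) (a b : L) :
  ext_comp (etens g a) (etens f b) = etens (g \oc f) (a * b).
Proof. exact: ext_map2_tens (@kcomp_bilinear K C A B D) _ _ _ _. Qed.

Let ext_compDl A B D (f : HomL A B) :
  {morph (@ext_comp A B D)^~ f : x y / x + y}.
Proof. exact: ext_map2Dl (@kcomp_bilinear K C A B D) f. Qed.

Let ext_compDr A B D (g : HomL B D) : {morph @ext_comp A B D g : x y / x + y}.
Proof. exact: ext_map2Dr (@kcomp_bilinear K C A B D) g. Qed.

Fact ext_compA A B D E (h : HomL D E) (g : HomL B D) (f : HomL A B) :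
  ext_comp h (ext_comp g f) = ext_comp (ext_comp h g) f.
Proof.
move: h; apply: ext_eq => [x y|x y|h a]; rewrite ?ext_compDl //.
move: g; apply: ext_eq => [x y|x y|g b];
  rewrite ?ext_compDl ?ext_compDr ?ext_compDl //.
move: f; apply: ext_eq => [x y|x y|f c]; rewrite ?ext_compDr //.
by rewrite !ext_comp_tens kcompA mulrA.
Qed.

Fact ext_comp1m A B (f : HomL A B) : ext_comp (ext_id B) f = f.
Proof.
move: f; apply: ext_eq => [x y|x y|f c]; rewrite ?ext_compDr //.
by rewrite ext_comp_tens kcomp1m mul1r.
Qed.

Fact ext_compm1 A B (f : HomL A B) : ext_comp f (ext_id A) = f.
Proof.
move: f; apply: ext_eq => [x y|x y|f c]; rewrite ?ext_compDl //.
by rewrite ext_comp_tens kcompm1 mulr1.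
Qed.

Fact ext_comp_bilinear A B D :
  bilinear_for *:%R *:%R
    (@ext_comp A B D : (HomL B D : lmodType L) -> (HomL A B : lmodType L) ->
                       (HomL A D : lmodType L)).
Proof. exact: ext_map2_bilinear (@kcomp_bilinear K C A B D). Qed.

Fact ext_zero_object : exists Z, forall A,
  (forall f : HomL A Z, f = 0) /\ (forall f : HomL Z A, f = 0).
Proof.
have [Z Z0] := zero_object C; exists Z => A; have [AZ ZA] := Z0 A.
split; apply: ext_ind => // [x y -> ->|f a]; rewrite ?addr0 //.
  by rewrite (AZ f) etens0l.
by rewrite (ZA f) etens0l.
Qed.

Fact ext_biproducts A B : exists P,
  exists (i : HomL A P) (j : HomL B P) (p : HomL P A) (q : HomL P B),
    [/\ ext_comp p i = ext_id A, ext_comp q j = ext_id B,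
        ext_comp p j = 0, ext_comp q i = 0 &
        ext_comp i p + ext_comp j q = ext_id P].
Proof.
have [P [i [j [p [q [pi qj pj qi ij]]]]]] := biproducts A B.
exists P, (etens i 1), (etens j 1), (etens p 1), (etens q 1).
by rewrite !ext_comp_tens pi qj pj qi mulr1 !etens0l -etensDl ij.
Qed.

Definition ext_category : kcategory L :=
  @KCategory L (Ob C) (fun A B => HomL A B : lmodType L) ext_id ext_comp
    ext_compA ext_comp1m ext_compm1 ext_comp_bilinear
    ext_zero_object ext_biproducts.

Section Hermitian.
Variable h : hermitian_structure C.

Definition ext_dualm A B : HomL A B -> HomL (hdual h B) (hdual h A) :=
  ext_map (@hdualm K C h A B).

Definition ext_omega A : HomL A (hdual h (hdual h A)) := etens (omega h A) 1.

Let ext_dualm_tens A B (f : khom A B) (a : L) :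
  ext_dualm (etens f a) = etens (hdualm h f) a.
Proof. exact: ext_map_tens (@hdualm_linear K C h A B) _ _. Qed.

Let ext_dualmD A B : {morph @ext_dualm A B : x y / x + y}.
Proof. exact: ext_mapD (@hdualm_linear K C h A B). Qed.

Fact ext_dualm_id A : ext_dualm (ext_id A) = ext_id (hdual h A).
Proof. by rewrite ext_dualm_tens hdualm_id. Qed.

Fact ext_dualm_comp A B D (g : HomL B D) (f : HomL A B) :
  ext_dualm (ext_comp g f) = ext_comp (ext_dualm f) (ext_dualm g).
Proof.
move: g; apply: ext_eq => [x y|x y|g a].
- by rewrite ext_compDl ext_dualmD.
- by rewrite ext_dualmD ext_compDr.
move: f; apply: ext_eq => [x y|x y|f b].
- by rewrite ext_compDr ext_dualmD.
- by rewrite ext_dualmD ext_compDl.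
by rewrite ext_comp_tens !ext_dualm_tens ext_comp_tens hdualm_comp mulrC.
Qed.

Fact ext_dualm_linear A B :
  linear (@ext_dualm A B : (HomL A B : lmodType L) ->
                           (HomL (hdual h B) (hdual h A) : lmodType L)).
Proof. exact: ext_map_linear (@hdualm_linear K C h A B). Qed.

Fact ext_omega_natural A B (f : HomL A B) :
  ext_comp (ext_omega B) f = ext_comp (ext_dualm (ext_dualm f)) (ext_omega A).
Proof.
move: f; apply: ext_eq => [x y|x y|f a].
- by rewrite ext_compDr.
- by rewrite !ext_dualmD ext_compDl.
by rewrite !ext_dualm_tens !ext_comp_tens omega_natural mulrC.
Qed.

Fact ext_omega_dual A :
  ext_comp (ext_dualm (ext_omega A)) (ext_omega (hdual h A)) =
  ext_id (hdual h A).
Proof. by rewrite ext_dualm_tens ext_comp_tens omega_dual mulr1. Qed.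

Definition ext_hermitian : hermitian_structure ext_category :=
  @Hermitian L ext_category (hdual h) ext_dualm ext_dualm_id ext_dualm_comp
    ext_dualm_linear ext_omega ext_omega_natural ext_omega_dual.

End Hermitian.

(* R_{L/K} on objects *)
Definition base_change (I : Type) (H : I -> hermitian_structure C)
    (S : sesq_system H) : sesq_system (fun i => ext_hermitian (H i)) :=
  @SesqSystem L ext_category I (fun i => ext_hermitian (H i)) (carrier S)
    (fun i => etens (sform S i) 1).

End CategoryExtension.

Arguments ext_category {K} L C.
Arguments base_change {K} L {C I H} S.

(* Main.v *)
(* An isometry f : (M, s) -> (M', s') is the same as a pair (f, g) with        *)
(* s' f = g^* s and s g = f^* s' that is unitary for the swap (f, g) |-> (g, f). *)
(* So the systems become symmetric idempotents e, e' of a finite-dimensional   *)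
(* algebra R with involution, and isometry becomes unitary equivalence.        *)
(* Following Bayer-Fluckiger and Lenstra, choose a K-linear s : L -> K whose   *)
(* form s (x y) is <1> plus a hyperbolic form, which exists because the degree *)
(* is odd: on K(t)/K of degree 2m + 1 let s (1) = 1 and s (t^k) = 0 for        *)
(* 0 < k <= 2m, so that t, ..., t^m span a totally isotropic subspace.         *)
(* Transferring an isometry over L along s gives an isometry over K between    *)
(* e + hyperbolic and e' + hyperbolic in a matrix algebra over R.  The         *)
(* underlying idempotents are isomorphic by Noether-Deuring, so the hyperbolic *)
(* parts agree and can be cancelled: hyperbolic summands over isomorphic local *)
(* Lagrangians have isometric complements, since two such Lagrangians are      *)
(* joined by a chain in which consecutive ones are opposite or equal.          *)

Require Import Defs.
From HB Require Import structures.
From mathcomp Require Import all_boot all_order all_algebra all_field.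
From mathcomp Require Import boolp.
From mathcomp Require Import zify.

Set Implicit Arguments.
Unset Strict Implicit.
Unset Printing Implicit Defensive.

Import GRing.Theory.
Local Open Scope ring_scope.

(** An isometry and its inverse satisfy the linear relations of [adjoint_pair]. In the ring [adj] of
    the orthogonal sum of the two systems, the projections to M and M' are symmetric idempotents e
    and e', and a unitary equivalence between them restricts to an isometry of the systems
    ([isometric_of_unitary_equiv]).

    Over L there is a K-basis whose Gram matrix for s (x y) is a permutation matrix of an involution
    with one fixed index ([transfer_basis_exists]). Written in this basis, an isometry over L is a
    unitary equivalence over K between dim L copies of e and of e', the adjoint being twisted by the
    permutation ([transfer_mx_unitary]). The fixed index contributes e itself and the exchanged
    indices contribute a hyperbolic summand ([scalar_mx_half]), which [unitary_equiv_scalar_mx]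
    cancels.

    This rests on two facts. By [equiv_idem_scalar_mx], e and e' are equivalent when their multiples
    are, so the Lagrangians of the two hyperbolic summands are isomorphic. By [hyperbolic_cancel],
    hyperbolic summands over isomorphic Lagrangians have isometric complements; induction on the
    rank reduces this to a primitive idempotent, whose corner ring is local by Fitting's lemma. *)

(** * Finite-dimensional algebras *)

Lemma vspace_of_submod (K : fieldType) (V : vectType K) (P : V -> Prop) :
    P 0 -> (forall k u v, P u -> P v -> P (k *: u + v)) ->
  exists U : {vspace V}, forall v, v \in U <-> P v.
Proof.
(* A subspace of maximal dimension inside [P] is all of [P]: adjoining the line of a vector of [P]
   stays inside [P], so it cannot raise the dimension. *)
move=> P0 PZD; pose good n := `[< exists2 U : {vspace V}, \dim U = n & forall v, v \in U -> P v >].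
have ex_good : exists n, good n.
  exists 0%N; apply/asboolP; exists 0%VS; first exact: dimv0.
  by move=> v; rewrite memv0 => /eqP ->.
have le_good n : good n -> (n <= \dim {: V})%N.
  by move=> /asboolP[U <- _]; rewrite dimvS ?subvf.
case: (ex_maxnP ex_good le_good) => n /asboolP[U dimU UP] maxn.
exists U => v; split=> [|Pv]; first exact: UP.
have /maxn : good (\dim (U + <[v]>)%VS).
  apply/asboolP; exists (U + <[v]>)%VS => // _ /memv_addP[u Uu [_ /vlineP[k ->] ->]].
  by rewrite addrC; apply: PZD => //; apply: UP.
rewrite -dimU => leU; have /eqP -> : U == (U + <[v]>)%VS.
  by rewrite eqEdim addvSl.
by rewrite (subvP (addvSr U <[v]>)) ?memv_line.
Qed.

(* R is a finite-dimensional K-algebra, with c k standing for k * 1. *)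
Definition finite_over (K : fieldType) (R : pzRingType) : Prop :=
  exists (V : vectType K) (iota : {additive R -> V}) (c : K -> R),
    [/\ injective iota, forall k x, iota (x * c k) = k *: iota x &
        forall k x, c k * x = x * c k].

Lemma finite_over_pair (K : fieldType) (R S : pzRingType) :
  finite_over K R -> finite_over K S -> finite_over K (R * S)%type.
Proof.
move=> [V [i [c [inji iZ cC]]]] [W [j [d [injj jZ dC]]]].
pose f (x : R * S) : V * W := (i x.1, j x.2).
have fB : zmod_morphism f by move=> x y; rewrite /f !raddfB.
pose F := HB.pack_for {additive (R * S)%type -> (V * W)%type} f
  (GRing.isZmodMorphism.Build _ _ f fB).
exists (V * W)%type, F, (fun k => (c k, d k)); split=> [[x y] [x' y']|k [x y]|k [x y]].
- by case=> /inji -> /injj ->.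
- by rewrite /= /f /= iZ jZ.
- by congr (_, _); [exact: cC | exact: dC].
Qed.

Lemma finite_over_converse (K : fieldType) (R : pzRingType) :
  finite_over K R -> finite_over K R^c.
Proof.
move=> [V [i [c [inji iZ cC]]]].
exists V, i, c; split=> // k x; last exact/esym/cC.
by rewrite -iZ -cC.
Qed.

Lemma finite_over_matrix (K : fieldType) (R : pzRingType) n :
  finite_over K R -> finite_over K 'M[R]_n.
Proof.
move=> [V [i [c [inji iZ cC]]]].
pose f (A : 'M[R]_n) : {ffun 'I_n * 'I_n -> V} := [ffun k => i (A k.1 k.2)].
have fB : zmod_morphism f.
  by move=> x y; apply/ffunP => k; rewrite !ffunE !mxE raddfB.
pose F := HB.pack_for {additive 'M[R]_n -> {ffun 'I_n * 'I_n -> V}} f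
  (GRing.isZmodMorphism.Build _ _ f fB).
exists {ffun 'I_n * 'I_n -> V}, F, (fun k => (c k)%:M); split=> [A B|k A|k A].
- move=> /ffunP fAB; apply/matrixP => a b.
  by apply: inji; move: (fAB (a, b)); rewrite /= /f !ffunE.
- apply/ffunP => l; rewrite /= /f !ffunE -iZ; congr (i _).
  rewrite -mulmxE mxE (bigD1 l.2) //= big1 => [|j /negPf jl]; rewrite mxE ?eqxx ?addr0 //.
  by rewrite jl mulr0.
- rewrite -mulmxE mul_scalar_mx; apply/matrixP => a b.
  rewrite !mxE (bigD1 b) //= big1 ?addr0 => [|j /negPf jl]; last by rewrite mxE jl mulr0.
  by rewrite mxE eqxx cC.
Qed.

(** * Rank of an element and stable powers *)

Section RankFunction.
Variable R : pzRingType.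

(** These three properties carry all the finiteness used for primitive idempotents and for
    hyperbolic cancellation, which can then be treated without scalars. *)
Record rank_function (d : R -> nat) : Prop := RankFunction {
  rankMl : forall r s : R, (d (r * s)%R <= d r)%N;
  rankMl_eq : forall r s : R, d (r * s) = d r -> exists y, r = r * s * y;
  rank_stable : forall r : R, exists2 m, (0 < m)%N &
    (exists y : R, r ^+ m = r ^+ m * r ^+ m * y) /\
    (forall x : R, r ^+ m * r ^+ m * x = 0 -> r ^+ m * x = 0)
}.

(* The rank of r is the dimension of the right ideal r R.  The stable power in *)
(* [rank_stable] is the one of Fitting's lemma: the image and the kernel of    *)
(* left multiplication by r ^+ m are both stationary.                          *)
Lemma rank_function_exists (K : fieldType) :
  finite_over K R -> exists d, rank_function d.
Proof.
move=> [V [i [c [inji iZ cC]]]].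
have imV r : exists U : {vspace V}, forall v, v \in U <-> exists x, v = i (r * x).
  apply: vspace_of_submod => [|k _ _ [x ->] [y ->]].
    by exists 0; rewrite mulr0 raddf0.
  by exists (x * c k + y); rewrite mulrDr raddfD mulrA iZ.
have kerV r : exists U : {vspace V}, forall v, v \in U <-> exists2 x, r * x = 0 & v = i x.
  apply: vspace_of_submod => [|k _ _ [x rx ->] [y ry ->]].
    by exists 0; rewrite ?mulr0 ?raddf0.
  by exists (x * c k + y); rewrite ?mulrDr ?raddfD ?mulrA ?rx ?iZ ?mul0r ?add0r.
have [im imE] := choice imV; have [ker kerE] := choice kerV.
have imS (r s : R) : (im (r * s)%R <= im r)%VS.
  by apply/subvP => v /imE[x ->]; apply/imE; exists (s * x); rewrite mulrA.
have kerS (r s : R) : (ker r <= ker (s * r)%R)%VS.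
  by apply/subvP => v /kerE[x rx ->]; apply/kerE; exists x; rewrite // -mulrA rx mulr0.
have im_eq (r s : R) : \dim (im (r * s)) = \dim (im r) -> exists y, r = r * s * y.
  move=> dim_eq; have /eqP im_eq : im (r * s) == im r.
    by rewrite eqEdim imS dim_eq leqnn.
  have : i r \in im (r * s) by rewrite im_eq; apply/imE; exists 1; rewrite mulr1.
  by move=> /imE[y /inji]; exists y.
exists (fun r => \dim (im r)); split=> // [r s|r]; first exact: dimvS.
(* [D] adds the dimension of the image and the codimension of the kernel. Neither grows when the
   exponent is doubled, so at some point [D], and with it both terms, stays the same. *)
pose D r := (\dim (im r) + (\dim {: V} - \dim (ker r)))%N.
have [m m_gt0 D_eq] : exists2 m, (0 < m)%N & D (r ^+ m) = D (r ^+ m * r ^+ m).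
  have [n] := ubnP (D (r ^+ 1)); move: {2 3}1%N (isT : 0 < 1)%N.
  elim: n => // n IHn k k_gt0 le_n.
  have [|] := eqVneq (D (r ^+ k)) (D (r ^+ k * r ^+ k)); first by exists k.
  rewrite -exprD => neqD; apply: (IHn (k + k)%N); first by rewrite addn_gt0 k_gt0.
  suff : (D (r ^+ (k + k))%R <= D (r ^+ k)%R)%N.
    by rewrite leq_eqVlt eq_sym (negPf neqD) /= => /leq_trans; apply.
  by rewrite exprD leq_add ?leq_sub ?dimvS.
exists m => //; move: (r ^+ m) D_eq => x D_eq.
have le_im : (\dim (im (x * x)%R) <= \dim (im x))%N by rewrite dimvS.
have le_ker : (\dim (ker x) <= \dim (ker (x * x)%R))%N by rewrite dimvS.
have ker_le : (\dim (ker (x * x)%R) <= \dim {: V})%N by rewrite dimvS ?subvf.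
have [eq_im eq_ker] : \dim (im (x * x)) = \dim (im x) /\
    \dim (ker (x * x)) = \dim (ker x).
  by move: D_eq; rewrite /D; lia.
split=> [|y xxy0]; first exact: im_eq eq_im.
have /eqP ker_eq : ker x == ker (x * x) by rewrite eqEdim kerS eq_ker leqnn.
have : i y \in ker x by rewrite ker_eq; apply/kerE; exists y.
by move=> /kerE[z xz0 /inji ->].
Qed.
End RankFunction.

(** * Idempotents and their corner rings *)

Section Idempotents.
Variable R : pzRingType.
Implicit Types a b e p q r x y z : R.

Definition subidem p e := e * p = p /\ p * e = p.

(** Left multiplications by [b] and [a] are mutually inverse isomorphisms between the right ideals
    [p R] and [q R]. *)
Definition equiv_idem p q :=
  exists a b, [/\ a * b = p, b * a = q, p * a = a & q * b = b].

(** Invertibility in the corner ring [p R p], the endomorphism ring of [p R], whose identity is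
    [p]. *)
Definition corner_unit p r :=
  exists y, [/\ p * y = y, y * p = y, r * y = p & y * r = p].

Definition primitive_idem p :=
  [/\ p * p = p, p <> 0 & forall q, q * q = q -> subidem q p -> q = 0 \/ q = p].

Lemma equiv_idem_mulr p q a b :
  a * b = p -> b * a = q -> p * a = a -> q * b = b -> a * q = a /\ b * p = b.
Proof. by move=> <- <- aE bE; rewrite !mulrA bE aE. Qed.

Lemma equiv_idem_idem p q :
  equiv_idem p q -> p * p = p /\ q * q = q.
Proof.
move=> [a [b [ab ba pa qb]]]; split; first by rewrite -{2}ab mulrA pa.
by rewrite -{2}ba mulrA qb.
Qed.

Lemma equiv_idem_refl p : p * p = p -> equiv_idem p p.
Proof. by move=> pp; exists p, p. Qed.

Lemma equiv_idem_sym p q : equiv_idem p q -> equiv_idem q p.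
Proof. by move=> [a [b [ab ba pa qb]]]; exists b, a. Qed.

Lemma equiv_idem_trans q p r : equiv_idem p q -> equiv_idem q r -> equiv_idem p r.
Proof.
move=> [a [b [ab ba pa qb]]] [c [e [ce ec qc re]]].
have [aq bp] := equiv_idem_mulr ab ba pa qb.
have [cr eq] := equiv_idem_mulr ce ec qc re.
exists (a * c), (e * b); split; rewrite !mulrA ?pa ?re //.
  by rewrite -(mulrA a) ce aq.
by rewrite -(mulrA e) ba eq.
Qed.

Lemma equiv_idemD p1 p2 q1 q2 :
    p1 * p2 = 0 -> p2 * p1 = 0 -> q1 * q2 = 0 -> q2 * q1 = 0 ->
  equiv_idem p1 q1 -> equiv_idem p2 q2 -> equiv_idem (p1 + p2) (q1 + q2).
Proof.
move=> p12 p21 q12 q21 [a [b [ab ba pa qb]]] [c [e [ce ec pc qe]]].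
have [aq bp] := equiv_idem_mulr ab ba pa qb.
have [cq ep] := equiv_idem_mulr ce ec pc qe.
have ae : a * e = 0 by rewrite -aq -qe mulrA -(mulrA a) q12 mulr0 mul0r.
have cb : c * b = 0 by rewrite -cq -qb mulrA -(mulrA c) q21 mulr0 mul0r.
have bc : b * c = 0 by rewrite -bp -pc mulrA -(mulrA b) p12 mulr0 mul0r.
have ea : e * a = 0 by rewrite -ep -pa mulrA -(mulrA e) p21 mulr0 mul0r.
have pc0 : p1 * c = 0 by rewrite -pc mulrA p12 mul0r.
have pa0 : p2 * a = 0 by rewrite -pa mulrA p21 mul0r.
have qe0 : q1 * e = 0 by rewrite -qe mulrA q12 mul0r.
have qb0 : q2 * b = 0 by rewrite -qb mulrA q21 mul0r.
exists (a + c), (b + e); split; rewrite mulrDl !mulrDr.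
- by rewrite ab ce ae cb addr0 add0r.
- by rewrite ba ec bc ea addr0 add0r.
- by rewrite pa pc pc0 pa0 addr0 add0r.
- by rewrite qb qe qe0 qb0 addr0 add0r.
Qed.

(** In a local ring the nonunits are closed under addition: if [y] inverts [r + s], then [y * r] and
    [y * s] add up to [p], so one of them is a unit, and cancelling [y] keeps it one. *)
Lemma corner_unitD p r s :
  p * p = p -> (forall x, p * x = x -> x * p = x -> corner_unit p x \/ corner_unit p (p - x)) ->
  p * r = r -> r * p = r -> p * s = s -> s * p = s ->
  corner_unit p (r + s) -> corner_unit p r \/ corner_unit p s.
Proof.
move=> pp locp pr rp ps sp [y [py yp ry yr]].
have unit_mulr t : p * t = t -> t * p = t -> corner_unit p (y * t) -> corner_unit p t.
  move=> pt tp [z [pz zp tz zt]]; exists (z * y); split.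
  - by rewrite mulrA pz.
  - by rewrite -mulrA yp.
  - have -> : t = (r + s) * y * t by rewrite ry pt.
    by rewrite -[_ * y * t]mulrA -mulrA (mulrA (y * t)) tz py ry.
  - by rewrite -mulrA.
have [] := locp (y * r); rewrite ?mulrA ?py // -?mulrA ?rp //.
  by move/(unit_mulr _ pr rp); left.
have -> : p - y * r = y * s by rewrite -yr mulrDr addrC addKr.
by move/(unit_mulr _ ps sp); right.
Qed.

End Idempotents.

Section Local.
Variables (R : pzRingType) (d : R -> nat).
Hypothesis rankd : rank_function d.
Implicit Types a b e p q r x y z : R.

(** The geometric series in [r] inverts [1 - r]; cut down by [p], it inverts [p - r] in the
    corner. *)
Lemma nilp_corner_unit p r m :
  p * p = p -> p * r = r -> r * p = r -> (0 < m)%N -> r ^+ m = 0 -> corner_unit p (p - r).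
Proof.
move=> pp pr rp m_gt0 rm0.
pose s := \sum_(i < m) r ^+ i.
have sr : r * s = s * r.
  by rewrite mulr_sumr mulr_suml; apply: eq_bigr => i _; rewrite -exprS -exprSr.
have rs : (1 - r) * s = 1.
  have := subrX1 r m; rewrite rm0 sub0r -/s => /(congr1 -%R).
  by rewrite opprK -mulNr opprB => <-.
have rs' : s * (1 - r) = 1 by rewrite mulrBr mulr1 -sr -[X in X - _]mul1r -mulrBl.
have psp : p * s * p = p * s.
  rewrite /s mulr_sumr mulr_suml; apply: eq_bigr => -[[|i] lti] _ /=; rewrite ?expr0 ?mulr1 //.
  by rewrite exprSr -!mulrA rp.
have sp : s * p = p * s * p.
  rewrite /s mulr_sumr !mulr_suml; apply: eq_bigr => -[[|i] lti] _ /=.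
    by rewrite expr0 mulr1 mul1r.
  by rewrite exprS !mulrA pr.
exists (p * s); split.
- by rewrite mulrA pp.
- by rewrite psp.
- have -> : (p - r) * (p * s) = p * ((1 - r) * s).
    by rewrite mulrA mulrBl pp rp !mulrA mulrBr mulr1 pr.
  by rewrite rs mulr1.
- have -> : p - r = (1 - r) * p by rewrite mulrBl mul1r rp.
  by rewrite mulrA -(mulrA p) rs' mulr1.
Qed.

(** Fitting's lemma. A stable power [c] of [r] yields an idempotent [w] below [p] with the same
    image as [c]. If [w] is 0, then [r] is nilpotent; if [w] is [p], then [c], and hence [r], is
    invertible in the corner. *)
Lemma primitive_local p r :
  primitive_idem p -> p * r = r -> r * p = r -> corner_unit p r \/ corner_unit p (p - r).
Proof.
move=> [pp p_neq0 minp] pr rp.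
have [m m_gt0 [[y cE] c_inj]] := rank_stable rankd r.
move def_c: (r ^+ m) cE c_inj => c cE c_inj.
have pc : p * c = c by case: (m) m_gt0 def_c => // k _ <-; rewrite exprS mulrA pr.
have cp : c * p = c by case: (m) m_gt0 def_c => // k _ <-; rewrite exprSr -mulrA rp.
have {}cE : c = c * c * (y * p) by rewrite mulrA -cE cp.
pose w := c * (y * p).
have cw : c * w = c by rewrite mulrA -cE.
have wc : w * c = c.
  apply/eqP; rewrite -subr_eq0 /w -mulrA -[X in _ - X]mulr1 -mulrBr; apply/eqP.
  by apply: c_inj; rewrite mulrBr mulr1 mulrA -cE subrr.
have ww : w * w = w by rewrite {2}/w mulrA wc.
have pw : p * w = w by rewrite mulrA pc.
have wp : w * p = w by rewrite -!mulrA pp.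
have [w0|wE] := minp w ww (conj pw wp).
  right; apply: (nilp_corner_unit (m := m)) => //.
  by rewrite def_c -cw w0 mulr0.
have cpy : c * (p * y * p) = p by rewrite !mulrA cp -mulrA -[RHS]wE.
have pyc : p * y * p * c = p.
  apply/eqP; rewrite -subr_eq0; apply/eqP; set t := _ - _.
  have tE : t = c * (y * p * t).
    by rewrite mulrA -/w wE /t mulrBr !mulrA pp.
  rewrite tE; apply: c_inj; rewrite -mulrA -tE /t mulrBr cp.
  by rewrite mulrA cpy pc subrr.
have rm : c = r * r ^+ m.-1 by rewrite -def_c -exprS prednK.
have rm' : c = r ^+ m.-1 * r by rewrite -def_c -exprSr prednK.
pose z := r ^+ m.-1 * (p * y * p); pose z' := p * y * p * r ^+ m.-1.
have rz : r * z = p by rewrite mulrA -rm.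
have z'r : z' * r = p by rewrite -mulrA -rm'.
have pzE : p * z = z' * p by rewrite -{1}z'r -mulrA rz.
left; exists (p * z); split.
- by rewrite mulrA pp.
- by rewrite pzE -mulrA pp.
- by rewrite mulrA rp.
- by rewrite pzE -mulrA pr.
Qed.

Lemma rank_subidem_lt p q :
  q * q = q -> p * p = p -> subidem q p -> q <> p -> (d q < d p)%N.
Proof.
move=> qq pp [pq qp] q_neq; rewrite ltn_neqAle -{2}pq (rankMl rankd) andbT.
apply/eqP => dqp; have [|y pE] := rankMl_eq rankd (r := p) (s := q); first by rewrite pq.
by apply: q_neq; rewrite -qp {1 2}pE pq mulrA qq.
Qed.

Lemma subidem_trans p q e : subidem p q -> subidem q e -> subidem p e.
Proof. by move=> [qp pq] [eq qe]; split; [rewrite -qp mulrA eq | rewrite -pq -mulrA qe]. Qed.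

Lemma primitive_subidem p :
  p * p = p -> p <> 0 -> exists2 q, primitive_idem q & subidem q p.
Proof.
have [n] := ubnP (d p); elim: n p => // n IHn p le_n pp p0.
have [primp|] := pselect (primitive_idem p); first by exists p.
have [[q [qq qp q0 q_neq]]|no_q primp] :=
  pselect (exists q, [/\ q * q = q, subidem q p, q <> 0 & q <> p]).
  have lt_qp := rank_subidem_lt qq pp qp q_neq.
  have [|r primr rq] := IHn q _ qq q0; first exact: leq_trans lt_qp le_n.
  by exists r => //; apply: subidem_trans rq qp.
case: primp; split=> // q qq qp; apply: contrapT => /not_orP[q0 q_neq].
by apply: no_q; exists q.
Qed.

(* If x : p -> q and t : q -> p satisfy t x = 1, then x t is a nonzero         *)
(* idempotent below the primitive q.                                           *)
Lemma primitive_split p q x t :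
  p <> 0 -> primitive_idem q -> q * x = x -> x * p = x -> t * x = p -> t * q = t -> x * t = q.
Proof.
move=> p0 [qq _ minq] qx xp tx tq.
have [] // := minq (x * t); first by rewrite mulrA -(mulrA x) tx xp.
  by split; [rewrite mulrA qx | rewrite -mulrA tq].
move=> xt0; case: p0.
have <- : t * (x * t) * x = p by rewrite -!mulrA tx xp.
by rewrite xt0 mulr0 mul0r.
Qed.

End Local.

(** * Hermitian modules as symmetric idempotents, and their hyperbolic summands *)

Record involution (R : pzRingType) (sg : R -> R) : Prop := Involution {
  invoB : forall x y, sg (x - y) = sg x - sg y;
  invoM : forall x y, sg (x * y) = sg y * sg x;
  invoK : forall x, sg (sg x) = x
}.

Section Hyperbolic.
Variables (R : pzRingType) (sg : R -> R).
Hypothesis invo_sg : involution sg.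
Implicit Types a b e f g h p q t u x y z P Q : R.

Let sgB := invoB invo_sg.
Let sgM := invoM invo_sg.
Let sgK := invoK invo_sg.

Lemma invo0 : sg 0 = 0.
Proof. by rewrite -{1}(subrr 0) sgB subrr. Qed.

Lemma invoN x : sg (- x) = - sg x.
Proof. by rewrite -sub0r sgB invo0 sub0r. Qed.

Lemma invoD x y : sg (x + y) = sg x + sg y.
Proof. by rewrite -[y]opprK sgB [in RHS]invoN. Qed.

(* Symmetric idempotents e and f are hermitian modules, and x is an isometry   *)
(* between them.                                                               *)
Definition unitary_equiv e f :=
  exists x, [/\ sg x * x = e, x * sg x = f, x * e = x & f * x = x].

Lemma unitary_equiv_refl e : e * e = e -> sg e = e -> unitary_equiv e e.
Proof. by move=> ee se; exists e; rewrite se. Qed.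

Lemma unitary_equiv_sym e f : unitary_equiv e f -> unitary_equiv f e.
Proof.
move=> [x [xx xx' xe fx]]; exists (sg x); rewrite sgK; split=> //.
  by rewrite -{2}fx sgM -xx' sgM sgK.
by rewrite -{2}xe sgM -xx sgM sgK.
Qed.

Lemma equiv_idem_of_unitary e f : unitary_equiv e f -> equiv_idem e f.
Proof.
move=> [x [xx xx' xe fx]]; exists (sg x), x; split=> //.
by rewrite -{2}xe sgM -xx sgM sgK.
Qed.

Lemma unitary_equiv_trans f e g : unitary_equiv e f -> unitary_equiv f g -> unitary_equiv e g.
Proof.
move=> [x [xx xx' xe fx]] [y [yy yy' yf gy]]; exists (y * x); rewrite sgM; split.
- by rewrite mulrA -(mulrA _ _ y) yy -mulrA fx.
- by rewrite mulrA -(mulrA y) xx' yf.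
- by rewrite -mulrA xe.
- by rewrite mulrA gy.
Qed.

(* P cuts out a hyperbolic summand of the hermitian module e: the images of P  *)
(* and of sg P are totally isotropic and dual to each other.                   *)
Definition hyperbolic P e :=
  [/\ P * P = P, subidem P e, P * sg P = 0 & sg P * P = 0].

Lemma hyperbolic_sg P e : sg e = e -> hyperbolic P e -> hyperbolic (sg P) e.
Proof.
move=> se [PP [eP Pe] P1 P2]; split; rewrite ?sgK //; first by rewrite -sgM PP.
by split; rewrite -{1}se -sgM ?eP ?Pe.
Qed.

Lemma hyperbolic_compl P e :
    e * e = e -> sg e = e -> hyperbolic P e ->
  let E := e - P - sg P in [/\ E * E = E, sg E = E, e * E = E & E * e = E].
Proof.
move=> ee se [PP [eP Pe] Ps sP] E.
have ss : sg P * sg P = sg P by rewrite -sgM PP.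
have es : e * sg P = sg P by rewrite -{1}se -sgM Pe.
have se' : sg P * e = sg P by rewrite -{1}se -sgM eP.
split; rewrite /E ?sgB ?sgK ?se; last 2 first.
- by rewrite !mulrBr ee eP es.
- by rewrite !mulrBl ee Pe se'.
- by rewrite !(mulrBl, mulrBr) ee eP Pe PP Ps sP ss es se' !subr0 !subrr !subr0.
- by rewrite addrAC.
Qed.

(** Each complement maps isometrically onto the orthogonal of the common image modulo that image, so
    projecting one complement to the other is an isometry. *)
Lemma unitary_equiv_same_image P Q e :
    e * e = e -> sg e = e -> hyperbolic P e -> hyperbolic Q e -> P * Q = Q -> Q * P = P ->
  unitary_equiv (e - P - sg P) (e - Q - sg Q).
Proof.
move=> ee se hP hQ PQ QP.
have EFE P1 Q1 : hyperbolic P1 e -> P1 * Q1 = Q1 ->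
   (e - P1 - sg P1) * (e - Q1 - sg Q1) * (e - P1 - sg P1) = e - P1 - sg P1.
  move=> h1 PQ1; have [EE sE _ Ee] := hyperbolic_compl ee se h1.
  have [P11 [eP _] _ sP] := h1.
  have EP : (e - P1 - sg P1) * P1 = 0 by rewrite !mulrBl eP P11 sP subrr subr0.
  move: EP EE sE Ee; set E := e - P1 - sg P1 => EP EE sE Ee.
  have EQ : E * Q1 = 0 by rewrite -PQ1 mulrA EP mul0r.
  have QE : sg Q1 * E = 0 by rewrite -sE -sgM EQ invo0.
  by rewrite !(mulrBr E) Ee EQ subr0 mulrBl -(mulrA E) QE mulr0 subr0 EE.
have := EFE P Q hP PQ; have := EFE Q P hQ QP.
have [EE sE _ _] := hyperbolic_compl ee se hP.
have [FF sF _ _] := hyperbolic_compl ee se hQ.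
move: EE sE FF sF; set E := e - _ - _; set F := e - _ - _ => EE sE FF sF FEF EFE'.
exists (F * E); rewrite sgM sE sF; split.
- by rewrite mulrA -(mulrA E) FF.
- by rewrite mulrA -(mulrA F) EE.
- by rewrite -mulrA EE.
- by rewrite mulrA FF.
Qed.

(* Here p R and q R are isotropic and the pairing between them is perfect, so  *)
(* that they span a hyperbolic summand.                                        *)
Lemma unitary_equiv_opposite p q e z :
    e * e = e -> sg e = e -> hyperbolic p e -> hyperbolic q e ->
    q * z = z -> z * sg p = z -> sg p * q * z = sg p -> z * sg p * q = q ->
  unitary_equiv (e - p - sg p) (e - q - sg q).
Proof.
move=> ee se hp hq qz zp pqz zpq.
(* [z] projects onto [q R] along the orthogonal of [p R]. So [z] has the image of [q], and [sg z]
   has the image of [p]. *)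
have hz : hyperbolic z e.
  have [qq [eq qe] qs sq] := hq; have [pp [ep pe] ps sp] := hp.
  split.
  - by rewrite -{1}zp -{2}qz -mulrA (mulrA (sg p)) pqz.
  - split; first by rewrite -qz mulrA eq.
    by rewrite -zp -mulrA -{1}se -sgM ep.
  - by rewrite -zp sgM sgK -mulrA (mulrA (sg p)) sp mul0r mulr0.
  - by rewrite -qz sgM -mulrA (mulrA (sg q)) sq mul0r mulr0.
have zq : z * q = q by rewrite -{1}zp.
have zpp : sg z * p = p by rewrite -[X in _ = X]sgK -pqz -mulrA qz sgM sgK.
have pz : p * sg z = sg z by rewrite -{1}[p]sgK -sgM zp.
apply: (unitary_equiv_trans (f := e - sg z - sg (sg z))).
  by apply: unitary_equiv_same_image => //; apply: hyperbolic_sg.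
rewrite sgK addrAC; exact: unitary_equiv_same_image.
Qed.

End Hyperbolic.

(** * Cancellation of hyperbolic summands *)

Section Cancellation.
Variables (R : pzRingType) (sg : R -> R) (d : R -> nat).
Hypothesis invo_sg : involution sg.
Hypothesis rankd : rank_function d.
Implicit Types a b e f g h p q t u x y z P Q : R.

Let sgB := invoB invo_sg.
Let sgM := invoM invo_sg.
Let sgK := invoK invo_sg.
Let sgD := invoD invo_sg.

Lemma primitive_sg p : primitive_idem p -> primitive_idem (sg p).
Proof.
move=> [pp p0 minp]; split; first by rewrite -sgM pp.
  by move=> sp0; apply: p0; rewrite -[p]sgK sp0 invo0.
move=> q qq [pq qp].
have [| |sq|sq] := minp (sg q); first by rewrite -sgM qq.
- by split; rewrite -{1}[p]sgK -sgM ?pq ?qp.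
- by left; rewrite -[q]sgK sq invo0.
- by right; rewrite -[q]sgK sq.
Qed.

Lemma corner_unitN p r : corner_unit p (- r) -> corner_unit p r.
Proof.
move=> [y [py yp ry yr]]; exists (- y); rewrite !mulrN !mulNr py yp.
by rewrite -mulNr ry -mulrN yr.
Qed.

(* Here sg P, whose image is dual to that of P, is opposite to q. *)
Lemma unitary_equiv_opposite_sg P q e a b p y :
    e * e = e -> sg e = e -> hyperbolic sg P e -> hyperbolic sg q e ->
    a * b = q -> b * a = p -> q * a = a ->
    y * P = y -> P * a * y = P -> y * P * a = p ->
  unitary_equiv sg (e - P - sg P) (e - q - sg q).
Proof.
move=> ee se hP hq ab ba qa yP Pay yPa.
rewrite addrAC -{2}[P]sgK.
apply: (unitary_equiv_opposite invo_sg (z := a * y)) => //; rewrite ?sgK.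
- exact: hyperbolic_sg.
- by rewrite mulrA qa.
- by rewrite -mulrA yP.
- by rewrite mulrA -(mulrA P) qa.
- by rewrite -[in LHS]ab !mulrA -(mulrA a y) -(mulrA a) yPa -ba mulrA ab qa.
Qed.

(* Only the kernel of p is changed, which moves sg P into a position where it  *)
(* is opposite to q.                                                           *)
Lemma hyperbolic_perturb p q e b u :
    sg e = e -> hyperbolic sg p e -> hyperbolic sg q e ->
    p * b = b -> b * q = b -> p * u = u -> u * p = u ->
    (p + b * p) * u = p -> u * (p + b * p) = p ->
  let P := u * (p + b - b * sg u) in
  [/\ hyperbolic sg P e, p * P = P & P * p = p].
Proof.
move=> se [pp [ep pe] ps sp] [qq [eq qe] qs sq] pb bq pu up cu uc.
set K := p + b - b * sg u => P.
have su : sg u * sg p = sg u by rewrite -sgM pu.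
have su' : sg p * sg u = sg u by rewrite -sgM up.
have pP : p * P = P by rewrite mulrA pu.
have Kp : K * p = p + b * p.
  by rewrite mulrBl mulrDl pp -su -!mulrA sp !mulr0 subr0.
have Pp : P * p = p by rewrite -mulrA Kp.
have mu : (p + b) * u = p by rewrite -{1}pu mulrA mulrDl pp.
have usm : sg u * (sg p + sg b) = sg p by rewrite -sgD -sgM mu.
have uu : sg u * u = 0 by rewrite -{2}pu mulrA -su -(mulrA (sg u)) sp mulr0 mul0r.
have bb : b * sg b = 0 by rewrite -bq sgM -mulrA (mulrA q) qs mul0r mulr0.
have mm : (p + b) * (sg p + sg b) = p * sg b + b * sg p.
  by rewrite mulrDl !mulrDr ps bb addr0 add0r.
have KK : K * sg K = 0.
  rewrite /K sgB sgM sgK sgD mulrBl !mulrBr mm (mulrA _ u) mu -(mulrA b) usm.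
  by rewrite -(mulrA b) (mulrA (sg u)) uu mul0r mulr0 subr0 addrAC addrK subrr.
split=> //; split.
- by rewrite -{2}pP mulrA Pp.
- split; first by rewrite -{1}pP mulrA ep.
  have be : b * e = b by rewrite -{1}bq -mulrA qe bq.
  have eu : e * u = u by rewrite -{1}pu mulrA ep pu.
  have ue : sg u * e = sg u by rewrite -{1}se -sgM eu.
  by rewrite -mulrA mulrBl mulrDl pe be -(mulrA b) ue.
- by rewrite sgM mulrA -(mulrA u) KK mulr0 mul0r.
- by rewrite -{2}pP -pP sgM -mulrA (mulrA (sg p)) sp mul0r mulr0.
Qed.

(** Three cases are direct: [q] is opposite to [p], [q] is opposite to [sg p], or [p] is opposite to
    [sg q]. Otherwise locality of the corner makes [p + b * p] a unit, and [hyperbolic_perturb]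
    replaces [p] by some [P] with the same image such that [sg P] is opposite to [q]. *)
Lemma hyperbolic_cancel_primitive p q e :
    primitive_idem p -> e * e = e -> sg e = e -> hyperbolic sg p e -> hyperbolic sg q e ->
    equiv_idem p q ->
  unitary_equiv sg (e - p - sg p) (e - q - sg q).
Proof.
move=> primp ee se hp hq /equiv_idem_sym[a [b [ab ba qa pb]]].
have [ap bq] := equiv_idem_mulr ab ba qa pb.
have [pp p0 _] := primp; have [_ _ ps sp] := hp.
have loc r := primitive_local rankd (r := r) primp.
(* Here the pairing of [p R] with [q R] has a left inverse, which is two-sided because [sg p] is
   primitive. *)
have [[t tpa]|no_t] := pselect (exists t, t * sg p * a = p).
  have xt : sg p * a * (p * t * sg p) = sg p.
    apply: (primitive_split p0 (primitive_sg primp)); rewrite -?mulrA -?sgM ?pp ?ap //.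
      by rewrite mulrA -sgM pp.
    by rewrite (mulrA (sg p)) -sgM pp (mulrA t) tpa pp.
  apply: (unitary_equiv_opposite invo_sg (z := a * (p * t * sg p))) => //.
  - by rewrite mulrA qa.
  - by rewrite -!mulrA -sgM pp.
  - by rewrite mulrA -(mulrA _ q) qa.
  - rewrite -{1}ab -!mulrA (mulrA (sg p) (sg p)) -sgM pp.
    by rewrite (mulrA (sg p)) (mulrA t) (mulrA t) tpa !mulrA ap ap ab.
have [[y [py yp pay ypa]]|no_pa] := pselect (corner_unit p (p * a)).
  by apply: (unitary_equiv_opposite_sg (a := a) (b := b) (p := p) (y := y)); rewrite // -mulrA.
have [[h [ph hp' bph hbp]]|no_bp] := pselect (corner_unit p (b * p)).
  apply/unitary_equiv_sym => //.
  apply: (unitary_equiv_opposite_sg (a := p) (b := p) (p := p) (y := h * b)) => //.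
  - by rewrite -mulrA bq.
  - by rewrite mulrA -ab -!mulrA (mulrA p h) (mulrA b) (mulrA b) bph pb.
  - by rewrite -(mulrA h) bq -mulrA.
have [||/corner_unitN //|[u [pu up cu uc]]] := loc (- (b * p)).
- by rewrite mulrN mulrA pb.
- by rewrite mulNr -mulrA pp.
rewrite opprK in cu uc.
have [hP pP Pp] := hyperbolic_perturb se hp hq pb bq pu up cu uc.
move: hP pP Pp; set K := p + b - b * sg u; set P := u * K => hP pP Pp.
have PP : P * P = P by case: hP.
apply: (unitary_equiv_trans invo_sg (f := e - P - sg P)) => //.
  exact: unitary_equiv_same_image.
have Ka : K * a = p - (b * sg u * a - p * a).
  by rewrite /K mulrBl mulrDl ba opprB addrA (addrC (p * a)).
have su : sg u * sg p = sg u by rewrite -sgM pu.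
have pbua : p * (b * sg u * a) = b * sg u * a by rewrite !mulrA pb.
have buap : b * sg u * a * p = b * sg u * a by rewrite -!mulrA ap.
have ppa : p * (p * a) = p * a by rewrite mulrA pp.
have pap : p * a * p = p * a by rewrite -mulrA ap.
(* [K * a] is [p] minus a difference of two nonunits, hence a unit: the first term is a nonunit by
   [no_t], the second by [no_pa]. *)
have [||un|] := loc (b * sg u * a - p * a); rewrite ?mulrBr ?mulrBl ?ppa ?pbua ?buap ?pap //.
  have [||||[y [_ _ _ yb]]|/corner_unitN //] := corner_unitD pp loc _ _ _ _ un.
  - by [].
  - by [].
  - by rewrite mulrN ppa.
  - by rewrite mulNr pap.
  by case: no_t; exists (y * (b * sg u)); rewrite -!mulrA (mulrA (sg u)) su -yb !mulrA.
rewrite -Ka => -[y [py yp Kay yKa]].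
pose g := y * (p + b * p).
have Pag : P * a * g = p by rewrite /g mulrA -(mulrA _ a) -(mulrA u) (mulrA K) Kay up uc.
have gPa : g * P * a = p by rewrite /g -!mulrA (mulrA (p + _)) cu (mulrA y) yp.
apply: (unitary_equiv_opposite_sg (a := a) (b := b) (p := p) (y := g * P)) => //.
- by rewrite -mulrA PP.
- by rewrite mulrA Pag pP.
- by rewrite -(mulrA g) PP gPa.
Qed.

End Cancellation.

Lemma equiv_idem_subidem (R : pzRingType) (p q p1 : R) :
    equiv_idem p q -> p1 * p1 = p1 -> subidem p1 p ->
  exists q1, [/\ q1 * q1 = q1, subidem q1 q, equiv_idem p1 q1 & equiv_idem (p - p1) (q - q1)].
Proof.
move=> [a [b [ab ba pa qb]]] p11 p1p.
have [aq bp] := equiv_idem_mulr ab ba pa qb.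
have pp : p * p = p by rewrite -{2}ab mulrA pa.
have eqv r : r * r = r -> subidem r p -> equiv_idem r (b * r * a).
  move=> rr [pr rp]; exists (r * a), (b * r); split.
  - by rewrite mulrA -(mulrA r) ab rp rr.
  - by rewrite !mulrA -(mulrA b) rr.
  - by rewrite mulrA rr.
  - by rewrite !mulrA -(mulrA _ a) ab -(mulrA b) rp -(mulrA b) rr.
have [_ q11] := equiv_idem_idem (eqv p1 p11 p1p).
have [pp1 p1p'] := p1p.
exists (b * p1 * a); split=> //; first by split; rewrite ?mulrA ?qb // -mulrA aq.
  exact: eqv.
have -> : q - b * p1 * a = b * (p - p1) * a by rewrite mulrBr mulrBl bp ba.
apply: eqv; first by rewrite mulrBl !mulrBr pp p11 pp1 p1p' subrr subr0.
by split; rewrite ?mulrBr ?mulrBl pp ?pp1 ?p1p'.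
Qed.

Section HyperbolicCancellation.
Variables (R : pzRingType) (sg : R -> R).
Hypothesis invo_sg : involution sg.
Implicit Types a b e f g h p q t u x y z P Q : R.

Let sgB := invoB invo_sg.
Let sgM := invoM invo_sg.
Let sgK := invoK invo_sg.

Lemma hyperbolic_subidem p p1 e :
  hyperbolic sg p e -> p1 * p1 = p1 -> subidem p1 p -> hyperbolic sg p1 e.
Proof.
move=> [pp [ep pe] ps sp] p11 [pp1 p1p]; split=> //.
- by split; [rewrite -pp1 mulrA ep | rewrite -p1p -mulrA pe].
- by rewrite -{1}p1p -{2}p1p sgM mulrA -(mulrA p1) ps mulr0 mul0r.
- by rewrite -{1}pp1 -{2}pp1 sgM mulrA -(mulrA (sg p1)) sp mulr0 mul0r.
Qed.

Lemma hyperbolic_diff p p1 e :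
    sg e = e -> hyperbolic sg p e -> p1 * p1 = p1 -> subidem p1 p ->
  hyperbolic sg (p - p1) (e - p1 - sg p1).
Proof.
move=> se hp p11 p1p; have [pp1 p1p'] := p1p; have [pp [ep pe] ps sp] := hp.
have [_ [ep1 p1e] ps1 sp1] := hyperbolic_subidem hp p11 p1p.
have dd : (p - p1) * (p - p1) = p - p1.
  by rewrite mulrBl !mulrBr pp p11 pp1 p1p' subrr subr0.
have ds : subidem (p - p1) p by split; rewrite ?mulrBr ?mulrBl pp ?pp1 ?p1p'.
have [_ [ed de] d1 d2] := hyperbolic_subidem hp dd ds.
split=> //; have s1p : sg p1 * p = 0 by rewrite -pp1 sgM -mulrA sp mulr0.
have ps1' : p * sg p1 = 0 by rewrite -p1p' sgM mulrA ps mul0r.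
by split; rewrite ?(mulrBl, mulrBr) ?ep ?pe ?ep1 ?p1e ?pp1 ?p1p' ?p11 ?sp1 ?ps1 ?s1p ?ps1' !subrr !subr0.
Qed.

Lemma unitary_equiv_hyperbolic e f Q :
    unitary_equiv sg e f -> hyperbolic sg Q f ->
  exists P, [/\ hyperbolic sg P e, equiv_idem P Q &
                unitary_equiv sg (e - P - sg P) (f - Q - sg Q)].
Proof.
move=> [x [xx xx' xe fx]] hQ; have [QQ [fQ Qf] Qs sQ] := hQ.
have sf : sg f = f by rewrite -xx' sgM sgK.
have se : sg e = e by rewrite -xx sgM sgK.
have ff : f * f = f by rewrite -{2}xx' mulrA fx.
have ex : e * sg x = sg x by rewrite -se -sgM xe.
have xf : sg x * f = sg x by rewrite -sf -sgM fx.
have xfx : sg x * f * x = e by rewrite xf.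
exists (sg x * Q * x); split.
- split.
  + by rewrite !mulrA -(mulrA _ x) xx' -(mulrA _ Q f) Qf -(mulrA _ Q Q) QQ.
  + by split; rewrite ?mulrA ?ex // -mulrA xe.
  + rewrite !sgM sgK !mulrA -(mulrA _ x) xx' -(mulrA _ Q f) Qf.
    by rewrite -(mulrA _ Q) Qs mulr0 mul0r.
  + rewrite !sgM sgK !mulrA -(mulrA _ x) xx' -(mulrA _ f Q) fQ.
    by rewrite -(mulrA _ _ Q) sQ mulr0 mul0r.
- exists (sg x * Q), (Q * x); split.
  + by rewrite mulrA -(mulrA _ Q Q) QQ.
  + by rewrite mulrA -(mulrA Q) xx' Qf QQ.
  + by rewrite !mulrA -(mulrA _ x) xx' -(mulrA _ Q f) Qf -(mulrA _ Q Q) QQ.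
  + by rewrite mulrA QQ.
have -> : e - sg x * Q * x - sg (sg x * Q * x) = sg x * (f - Q - sg Q) * x.
  by rewrite !mulrBr !mulrBl xfx !sgM sgK mulrA.
have [GG sG fG Gf] := hyperbolic_compl invo_sg ff sf hQ.
move: GG sG fG Gf; set G := f - Q - sg Q => GG sG fG Gf.
exists (G * x); rewrite sgM sG; split.
- by rewrite mulrA -(mulrA _ G G) GG.
- by rewrite mulrA -(mulrA G) xx' Gf GG.
- by rewrite !mulrA -(mulrA _ x) xx' Gf GG.
- by rewrite mulrA GG.
Qed.

(** Induction on the rank of [p]. A primitive [p1] below [p] has a counterpart [q1] below [q], and
    their complements are isometric. This isometry carries [q - q1] back to a hyperbolic [P]
    equivalent to [p - p1], and the induction hypothesis compares these two in the complement of
    [p1]. *)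
Lemma hyperbolic_cancel (d : R -> nat) p q e :
    rank_function d -> e * e = e -> sg e = e ->
    hyperbolic sg p e -> hyperbolic sg q e -> equiv_idem p q ->
  unitary_equiv sg (e - p - sg p) (e - q - sg q).
Proof.
move=> rankd; have [n] := ubnP (d p); elim: n p q e => // n IHn p q e le_n ee se hp hq pq.
have [pp _ _ _] := hp.
have [p0|p0] := pselect (p = 0).
  have q0 : q = 0.
    move: pq => [a [b [ab ba pa qb]]].
    by rewrite -ba -pa p0 mul0r mulr0.
  rewrite p0 q0; have [] := hyperbolic_compl invo_sg ee se hp.
  by rewrite p0 => *; apply: unitary_equiv_refl.
have [p1 primp1 p1p] := primitive_subidem rankd pp p0.
have [p11 p10 _] := primp1; have [pp1 p1p'] := p1p.
have [q1 [q11 q1q pq1 pq2]] := equiv_idem_subidem pq p11 p1p.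
have hp1 := hyperbolic_subidem hp p11 p1p; have hq1 := hyperbolic_subidem hq q11 q1q.
have u1 := hyperbolic_cancel_primitive invo_sg rankd primp1 ee se hp1 hq1 pq1.
have [P [hP Pq uP]] := unitary_equiv_hyperbolic u1 (hyperbolic_diff se hq q11 q1q).
have [EE sE _ _] := hyperbolic_compl invo_sg ee se hp1.
have [dd _] := equiv_idem_idem pq2.
have lt_d : (d (p - p1)%R < n)%N.
  apply: (@leq_trans (d p)) => //; apply: rank_subidem_lt => //.
    by split; rewrite ?mulrBr ?mulrBl pp ?pp1 ?p1p'.
  by move/eqP; rewrite -subr_eq0 addrAC subrr sub0r oppr_eq0 => /eqP.
have := IHn _ _ _ lt_d EE sE (hyperbolic_diff se hp p11 p1p) hP
  (equiv_idem_trans pq2 (equiv_idem_sym Pq)).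
move=> /(unitary_equiv_trans invo_sg)/(_ uP).
have diffE r r1 : e - r1 - sg r1 - (r - r1) - sg (r - r1) = e - r - sg r.
  rewrite sgB !opprB !addrA [LHS](ACl (1*5*7*(2*4)*(3*6))) /=.
  by rewrite !addNr !addr0.
by rewrite !diffE.
Qed.

End HyperbolicCancellation.

(* The ring R * R^c with the exchange involution turns cancellation of         *)
(* idempotents into hyperbolic cancellation.                                   *)
Lemma equiv_idem_cancel (K : fieldType) (R : pzRingType) (e p q : R) :
    finite_over K R -> e * e = e -> subidem p e -> subidem q e -> equiv_idem p q ->
  equiv_idem (e - p) (e - q).
Proof.
move=> finR ee [ep pe] [eq qe] pq; have [pp qq] := equiv_idem_idem pq.
have [d rankd] := rank_function_exists
  (finite_over_pair finR (finite_over_converse finR)).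
pose sg (x : (R * R^c)%type) : (R * R^c)%type := (x.2, x.1).
have invo_sg : involution sg by split=> [x y|x y|[]].
pose P (r : R) : (R * R^c)%type := (r, 0).
have pairP (x y : (R * R^c)%type) : x.1 = y.1 -> x.2 = y.2 -> x = y.
  by case: x y => [? ?] [? ?] /= -> ->.
have hP (r : R) : r * r = r -> e * r = r -> r * e = r -> hyperbolic sg (P r) (e, e).
  by move=> rr er re; split; [|split| |]; apply: pairP; rewrite /= ?mulr0 ?mul0r.
have [a [b [ab ba pa qb]]] := pq.
have PQ : equiv_idem (P p) (P q).
  by exists (P a), (P b); split; apply: pairP; rewrite /= ?mulr0.
have [||[x y] [xx yy xe fx]] := hyperbolic_cancel invo_sg rankd _ _ (hP p pp ep pe)
  (hP q qq eq qe) PQ.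
- exact: pairP.
- by [].
exists y, x; split.
- by have := congr1 fst xx; rewrite /= subr0.
- by have := congr1 fst yy; rewrite /= subr0.
- by have := congr1 snd xe; rewrite /= subr0.
- by have := congr1 fst fx; rewrite /= subr0.
Qed.

(** * Matrix algebras: multiples of an idempotent *)

Lemma corner_unit_sum (R : pzRingType) (p : R) (I : Type) (s : seq I) (r : I -> R) :
    p * p = p -> p <> 0 ->
    (forall x, p * x = x -> x * p = x -> corner_unit p x \/ corner_unit p (p - x)) ->
    (forall i, p * r i = r i /\ r i * p = r i) ->
  corner_unit p (\sum_(i <- s) r i) -> exists i, corner_unit p (r i).
Proof.
move=> pp p0 loc pr; elim: s => [|i s IHs].
  by rewrite big_nil => -[y [_ _]]; rewrite mul0r => /esym.
rewrite big_cons => un; have [pri rip] := pr i.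
have psum t : p * (\sum_(j <- t) r j) = \sum_(j <- t) r j.
  by rewrite mulr_sumr; apply: eq_bigr => j _; case: (pr j).
have sump t : (\sum_(j <- t) r j) * p = \sum_(j <- t) r j.
  by rewrite mulr_suml; apply: eq_bigr => j _; case: (pr j).
by have [|/IHs] := corner_unitD pp loc pri rip (psum s) (sump s) un; first by exists i.
Qed.

Section Matrices.
Variables (K : fieldType) (R : pzRingType).
Hypothesis finR : finite_over K R.
Implicit Types a b e f p q r x y : R.

Let mx_scalM n x y : (x%:M : 'M[R]_n) * y%:M = (x * y)%:M.
Proof. by rewrite -mulmxE -scalar_mxM. Qed.

(* The Noether-Deuring theorem. *)
Lemma equiv_idem_scalar_mx n p q :
  p * p = p -> q * q = q ->
  equiv_idem (p%:M : 'M[R]_n.+1) q%:M -> equiv_idem p q.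
Proof.
have [d rankd] := rank_function_exists finR.
have [m] := ubnP (d p); elim: m p q => // m IHm p q le_m pp qq pqM.
have [p0|p0] := pselect (p = 0).
  have [A [B [AB BA pA qB]]] := pqM.
  have /matrixP/(_ 0 0) : (q%:M : 'M[R]_n.+1) = 0.
    by rewrite -BA -pA p0 raddf0 mul0r mulr0.
  by rewrite !mxE => q0; rewrite p0 [q]q0; apply: equiv_idem_refl; rewrite mulr0.
have [p1 primp1 p1p] := primitive_subidem rankd pp p0.
have [p11 p10 _] := primp1; have [pp1 p1p'] := p1p.
have [A [B [AB BA pA qB]]] := pqM.
have [Aq Bp] := equiv_idem_mulr AB BA pA qB.
(* The sum of these products over [k] is [p1], so one of them is a unit of the local corner. The
   corresponding entries of [A] and [B] make [p1] equivalent to an idempotent below [q]. *)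
have [k [y [py yp ry yr]]] : exists k, corner_unit p1 (p1 * A 0 k * B k 0 * p1).
  apply: (corner_unit_sum (s := index_enum _)) => //.
  - by move=> x; apply: (primitive_local rankd).
  - by move=> k; rewrite !mulrA p11 -!mulrA p11.
  have -> : \sum_k p1 * A 0 k * B k 0 * p1 = p1.
    rewrite -mulr_suml.
    have -> : \sum_k p1 * A 0 k * B k 0 = p1 * (A * B) 0 0.
      rewrite -mulmxE mxE mulr_sumr.
      by apply: eq_bigr => k _; rewrite mulrA.
    by rewrite AB mxE eqxx mulr1n p1p' p11.
  by exists p1.
have Aqk : A 0 k * q = A 0 k.
  have /matrixP/(_ 0 k) := Aq; rewrite -mulmxE mxE (bigD1 k) //= big1 ?addr0 => [|j /negPf jk].
    by rewrite mxE eqxx.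
  by rewrite mxE jk mulr0.
have qBk : q * B k 0 = B k 0.
  by have /matrixP/(_ k 0) := qB; rewrite -mulmxE mul_scalar_mx mxE.
pose a := p1 * A 0 k; pose b := B k 0 * p1 * y.
have ab : a * b = p1 by rewrite /a /b !mulrA.
have aq : a * q = a by rewrite -mulrA Aqk.
have qb : q * b = b by rewrite /b !mulrA qBk.
have p1a : p1 * a = a by rewrite mulrA p11.
have bp1 : b * p1 = b by rewrite /b -mulrA yp.
have eq1 : equiv_idem p1 (b * a).
  by exists a, b; split=> //; rewrite -mulrA ab.
have [_ qq1] := equiv_idem_idem eq1.
have q1q : subidem (b * a) q by split; [rewrite mulrA qb | rewrite -(mulrA b) aq].
have [qq1' q1q'] := q1q.
have idem_sub r r1 : r * r = r -> r1 * r1 = r1 -> subidem r1 r -> (r - r1) * (r - r1) = r - r1.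
  by move=> rr r11 [rr1 r1r]; rewrite mulrBl !mulrBr rr r11 rr1 r1r subrr subr0.
have scal_idem r : r * r = r -> (r%:M : 'M[R]_n.+1) * r%:M = r%:M by move=> rr; rewrite mx_scalM rr.
have scal_sub r r1 : subidem r1 r -> subidem (r1%:M : 'M[R]_n.+1) r%:M.
  by case=> rr1 r1r; split; rewrite mx_scalM ?rr1 ?r1r.
have p1q1M : equiv_idem (p1%:M : 'M[R]_n.+1) (b * a)%:M.
  by exists a%:M, b%:M; split; rewrite mx_scalM ?ab ?p1a // -mulrA ab bp1.
have [Q1 [_ Q1q p1Q1 pQ]] := equiv_idem_subidem pqM (scal_idem _ p11) (scal_sub _ _ p1p).
(* The multiples of [p1] and of its counterpart in [q] are cancelled in the matrix algebra. *)
have pqM' : equiv_idem ((p - p1)%:M : 'M[R]_n.+1) (q - b * a)%:M.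
  rewrite !raddfB /=; apply: equiv_idem_trans pQ _.
  apply: (equiv_idem_cancel (finite_over_matrix _ finR)) => //; first exact: scal_idem.
    exact: scal_sub.
  exact: equiv_idem_trans (equiv_idem_sym p1Q1) p1q1M.
have lt_d : (d (p - p1)%R < m)%N.
  apply: (@leq_trans (d p)) => //; apply: rank_subidem_lt => //; first exact: idem_sub.
    by split; rewrite ?mulrBr ?mulrBl pp ?pp1 ?p1p'.
  by move/eqP; rewrite -subr_eq0 addrAC subrr sub0r oppr_eq0 => /eqP.
have := IHm _ _ lt_d (idem_sub _ _ pp p11 p1p) (idem_sub _ _ qq qq1 q1q) pqM'.
rewrite -[in X in _ -> X](subrKC p1 p) -[in X in _ -> X](subrKC (b * a) q).
by apply: equiv_idemD => //; rewrite ?mulrBr ?mulrBl ?p11 ?pp1 ?p1p' ?qq1 ?qq1' ?q1q' subrr.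
Qed.

Variables (sg : R -> R) (n : nat) (tau : 'I_n.+1 -> 'I_n.+1) (i0 : 'I_n.+1).
Hypothesis invo_sg : involution sg.
Hypothesis tauK : involutive tau.
Hypothesis tau_fix : forall i, (tau i == i) = (i == i0).

(* The adjoint of a matrix for the form whose Gram matrix is the permutation   *)
(* matrix of tau.                                                              *)
Definition mx_sg (X : 'M[R]_n.+1) : 'M[R]_n.+1 := \matrix_(i, j) sg (X (tau j) (tau i)).

Lemma involution_mx_sg : involution mx_sg.
Proof.
split=> [X Y|X Y|X]; apply/matrixP => i j; rewrite ?mxE.
- by rewrite -(invoB invo_sg).
- rewrite (reindex_inj (can_inj tauK)) /=.
  rewrite (big_morph sg (invoD invo_sg) (invo0 invo_sg)); apply: eq_bigr => k _.
  by rewrite (invoM invo_sg) /mx_sg !mxE.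
- by rewrite !tauK (invoK invo_sg).
Qed.

Definition sel_mx (c : pred 'I_n.+1) e : 'M[R]_n.+1 :=
  \matrix_(i, j) (e *+ ((i == j) && c i)).

Lemma sel_mulmx c e (X : 'M[R]_n.+1) i j : (sel_mx c e * X) i j = e * X i j *+ c i.
Proof.
rewrite -mulmxE mxE (bigD1 i) //= big1 ?addr0 => [|k ki]; rewrite mxE ?eqxx ?mulrnAl //.
by rewrite eq_sym (negPf ki) mulr0n.
Qed.

Lemma mulmx_sel c e (X : 'M[R]_n.+1) i j : (X * sel_mx c e) i j = X i j * e *+ c j.
Proof.
rewrite -mulmxE mxE (bigD1 j) //= big1 ?addr0 => [|k /negPf ki]; rewrite mxE ?eqxx ?mulrnAr //.
by rewrite ki mulr0n.
Qed.

Lemma sel_mxM c c' e f : sel_mx c e * sel_mx c' f = sel_mx (predI c c') (e * f).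
Proof.
apply/matrixP => i j; rewrite sel_mulmx !mxE mulrnAr -mulrnA mulnb /=.
by rewrite andbAC andbA.
Qed.

Lemma sel_mx_predT e : sel_mx predT e = e%:M.
Proof. by apply/matrixP => i j; rewrite !mxE andbT. Qed.

Lemma sel_mx_pred0 c e : c =1 pred0 -> sel_mx c e = 0.
Proof. by move=> c0; apply/matrixP => i j; rewrite !mxE c0 andbF. Qed.

Lemma eq_sel_mx c c' e : c =1 c' -> sel_mx c e = sel_mx c' e.
Proof. by move=> cc'; apply/matrixP => i j; rewrite !mxE cc'. Qed.

Lemma mx_sg_sel c e : mx_sg (sel_mx c e) = sel_mx (c \o tau) (sg e).
Proof.
apply/matrixP => i j; rewrite !mxE (inj_eq (can_inj tauK)) eq_sym.
by case: eqVneq => [->|_] /=; case: (c _); rewrite ?mulr1n ?mulr0n ?(invo0 invo_sg).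
Qed.

Lemma mx_sg_scalar e : sg e = e -> mx_sg e%:M = e%:M.
Proof. by move=> se; rewrite -sel_mx_predT mx_sg_sel se; apply: eq_sel_mx. Qed.

(* As i0 is the only fixed point of tau, n + 1 copies of e are the orthogonal  *)
(* sum of the copy at i0 and of a hyperbolic summand.                          *)
Let half : pred 'I_n.+1 := fun i => (i < tau i)%N.

Lemma scalar_mx_half e :
  sg e = e -> e%:M - sel_mx half e - mx_sg (sel_mx half e) = sel_mx (pred1 i0) e.
Proof.
move=> se; rewrite mx_sg_sel se; apply/matrixP => i j; rewrite !mxE /half /= tauK.
have [_|ij] := eqVneq i j; rewrite /= ?mulr0n ?subr0 // -tau_fix -val_eqE /=.
by case: ltngtP => _; rewrite ?mulr1n ?mulr0n ?subr0 ?subrr ?sub0r ?oppr0.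
Qed.

Lemma hyperbolic_half e :
  e * e = e -> sg e = e -> hyperbolic mx_sg (sel_mx half e) e%:M.
Proof.
move=> ee se; split; rewrite ?mx_sg_sel -?sel_mx_predT ?sel_mxM ?ee.
- by apply: eq_sel_mx => i; rewrite /= andbb.
- by split; rewrite sel_mxM ee; apply: eq_sel_mx => i; rewrite /= ?andbT.
- by apply: sel_mx_pred0 => i; rewrite /half /= tauK; case: ltngtP.
- by apply: sel_mx_pred0 => i; rewrite /half /= tauK; case: ltngtP.
Qed.

(** The hyperbolic parts have as Lagrangians equally many copies of [e] and of [f], which are
    equivalent by Noether-Deuring. Cancelling them leaves the copies at [i0]. *)
Lemma unitary_equiv_scalar_mx e f :
    e * e = e -> sg e = e -> f * f = f -> sg f = f ->
  unitary_equiv mx_sg e%:M f%:M -> unitary_equiv sg e f.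
Proof.
move=> ee se ff sf efM; have invoM := involution_mx_sg.
have [D rankD] := rank_function_exists (finite_over_matrix n.+1 finR).
have ef : equiv_idem e f.
  exact/(equiv_idem_scalar_mx ee ff)/(equiv_idem_of_unitary invoM).
have half_ef : equiv_idem (sel_mx half e) (sel_mx half f).
  have [a [b [ab ba ea fb]]] := ef; exists (sel_mx half a), (sel_mx half b).
  rewrite !sel_mxM ab ba ea fb.
  by split; apply: eq_sel_mx => i; rewrite /= andbb.
have [P [hP Pf uP]] := unitary_equiv_hyperbolic invoM efM (hyperbolic_half ff sf).
have eeM : (e%:M : 'M[R]_n.+1) * e%:M = e%:M by rewrite mx_scalM ee.
have := hyperbolic_cancel invoM rankD eeM (mx_sg_scalar se) (hyperbolic_half ee se) hP
  (equiv_idem_trans half_ef (equiv_idem_sym Pf)).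
move/(unitary_equiv_trans invoM)/(_ uP); rewrite !scalar_mx_half //.
move=> [X [/matrixP/(_ i0 i0) XX /matrixP/(_ i0 i0) XX' /matrixP Xe /matrixP fX]].
have ti0 : tau i0 = i0 by apply/eqP; rewrite tau_fix.
have X0l k j : k != i0 -> X k j = 0.
  by move=> /negPf k0; rewrite -fX sel_mulmx /= k0 mulr0n.
have X0r k j : j != i0 -> X k j = 0.
  by move=> /negPf k0; rewrite -Xe mulmx_sel /= k0 mulr0n.
exists (X i0 i0); split.
- move: XX; rewrite -mulmxE !mxE !eqxx (bigD1 i0) //= big1 ?addr0.
    by rewrite mxE ti0 eqxx.
  by move=> k k0; rewrite (X0l k) ?mulr0.
- move: XX'; rewrite -mulmxE !mxE !eqxx (bigD1 i0) //= big1 ?addr0.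
    by rewrite mxE ti0 eqxx.
  by move=> k k0; rewrite (X0r _ k) ?mul0r.
- by rewrite -[RHS]Xe mulmx_sel /= eqxx.
- by rewrite -[RHS]fX sel_mulmx /= eqxx.
Qed.

End Matrices.

(** * The transfer form of an extension of odd degree *)

Section TransferForm.
Variables (K : fieldType) (L : fieldExtType K).
Implicit Types (F : {subfield L}) (N : {vspace L}) (s : 'Hom(L, K^o)).

(* The form (x, y) |-> s (x * y) on F splits off <1>, and its complement has   *)
(* the totally isotropic subspace N of half its dimension.                     *)
Definition transfer_form F s N : Prop :=
  [/\ s 1 = 1, (forall x, x \in N -> s x = 0),
      (forall x y, x \in N -> y \in N -> s (x * y) = 0),
      (N <= F)%VS & (\dim F <= (\dim N).*2.+1)%N].

(** Let n = 2m + 1 be the degree of [x] over [F]. Then [s'] is [s] of the constant coefficient in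
    powers of [x], and [N'] consists of the polynomials in [x] of degree at most m with constant
    coefficient in [N]. A product of two of them has degree at most 2m < n, so its constant
    coefficient is the product of theirs. *)
Lemma transfer_form_adjoin F s N x :
    transfer_form F s N -> x \notin F -> odd (\dim <<F; x>>) ->
  exists s' N', transfer_form <<F; x>>%AS s' N'.
Proof.
move=> [s1 sN sNN sub_NF dimF] xF; rewrite dim_Fadjoin oddM => /andP[odd_n _].
have x_neq0 : x != 0 by apply: contraNneq xF => ->; rewrite mem0v.
set n := adjoin_degree F x in odd_n *.
pose m := n./2; have def_n : n = m.*2.+1 by rewrite -[LHS]odd_double_half odd_n.
pose t z := (Fadjoin_poly F x z)`_0.
have t_lin : linear t.
  by move=> a u v; rewrite /t linearP coefD coefZ mulr_algl.
pose T := HB.pack_for {linear L -> L} t (GRing.isLinear.Build _ _ _ _ t t_lin).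
have tE p : p \is a polyOver F -> (size p <= n)%N -> t p.[x] = p`_0.
  by move=> pF szp; rewrite /t (Fadjoin_poly_unique pF szp).
pose U (i : nat) : {vspace L} := (F * <[x ^+ i]>)%VS.
(* The part of [N'] in degree [i], padded by 0 beyond [m] so that the known directness of the sum
   over [i < n] applies. *)
pose W (i : nat) : {vspace L} :=
  if i == 0%N then N else if (i <= m)%N then U i else 0%VS.
have WU i : (W i <= U i)%VS.
  rewrite /W; case: eqP => [->|_]; first by rewrite /U expr0 prodv1.
  by case: ifP; rewrite ?sub0v.
have [N' N'P] : exists N' : {vspace L}, forall y, y \in N' <->
    exists p, [/\ p \is a polyOver F, (size p <= m.+1)%N, p`_0 \in N & y = p.[x]].
  apply: vspace_of_submod => [|a _ _ [p [pF szp pN ->]] [q [qF szq qN ->]]].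
    by exists 0; rewrite rpred0 size_poly0 coef0 mem0v horner0.
  exists (a%:A *: p + q); split.
  - by rewrite rpredD // polyOverZ // rpredZ // rpred1.
  - by rewrite (leq_trans (size_polyD _ _)) // geq_max szq (leq_trans (size_scale_leq _ _)).
  - by rewrite coefD coefZ mulr_algl rpredD ?rpredZ.
  - by rewrite hornerD hornerZ mulr_algl.
have WN' i : (W i <= N')%VS.
  apply/subvP => y; rewrite /W; case: eqP => [_ Ny|/eqP i0].
    apply/N'P; exists y%:P; rewrite polyOverC coefC hornerC (subvP sub_NF) //; split=> //.
    by rewrite (leq_trans (size_polyC_leq1 _)).
  case: ifP => [le_im /memv_cosetP[u Fu ->]|_]; last by rewrite memv0 => /eqP ->; apply: mem0v.
  apply/N'P; exists (u *: 'X^i); split.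
  - by rewrite polyOverZ // polyOverXn.
  - by rewrite (leq_trans (size_scale_leq _ _)) // size_polyXn.
  - by rewrite coefZ coefXn eq_sym (negPf i0) mulr0 mem0v.
  - by rewrite hornerZ hornerXn.
have dimN' : (\dim N + m * \dim F <= \dim N')%N.
  have dirW : directv (\sum_(i < n) W i).
    apply/directv_sum_independent => us usW us0.
    apply: (directv_sum_independent (Fadjoin_sum_direct F x)) us0 => i _.
    by apply: (subvP (WU i)); apply: usW.
  have subW : (\sum_(i < n) W i <= N')%VS by apply/subv_sumP => i _; apply: WN'.
  apply: leq_trans (dimvS subW); rewrite (directvP dirW) /=.
  rewrite -(big_mkord xpredT (fun i => \dim (W i))) def_n.
  rewrite (@big_cat_nat _ _ _ m.+1) //=; last by rewrite ltnS -addnn leq_addr.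
  rewrite big_nat_recl // -addnA leq_add // (leq_trans _ (leq_addr _ _)) //.
  rewrite (eq_big_nat _ _ (F2 := fun=> \dim F)) ?sum_nat_const_nat ?subn0 // => i /andP[_ lt_im].
  by rewrite /W /= lt_im dim_cosetv // expf_neq0.
exists (s \o linfun T)%VF, N'; split.
- by rewrite comp_lfunE lfunE /= /t Fadjoin_polyC ?rpred1 // coefC.
- move=> _ /N'P[p [pF szp pN ->]]; rewrite comp_lfunE lfunE /= tE ?sN //.
  by rewrite (leq_trans szp) // def_n ltnS -addnn leq_addr.
- move=> _ _ /N'P[p [pF szp pN ->]] /N'P[q [qF szq qN ->]].
  rewrite comp_lfunE lfunE /= -hornerM tE ?rpredM ?coef0M ?sNN //.
  rewrite (leq_trans (size_polyMleq _ _)) // def_n; lia.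
- by apply/subvP => _ /N'P[p [pF _ _ ->]]; apply: mempx_Fadjoin.
- by rewrite dim_Fadjoin -/n def_n; nia.
Qed.

(** [L] may fail to be simple over [K], so a subfield of maximal degree carrying such a form is
    taken. Adjoining a further element would give a larger one, as its degree divides that of [L]
    and is therefore odd. *)
Lemma transfer_form_exists : odd (\dim {:L}) -> exists s N, transfer_form {:L}%AS s N.
Proof.
move=> odd_L; pose good n := `[< exists F s N, \dim F = n /\ transfer_form F s N >].
have ex_good : exists n, good n.
  exists 1%N; apply/asboolP.
  have [s sE] : exists s : 'Hom(L, K^o), s 1 = 1.
    exists (linfun (coord [tuple (1 : L)] ord0 : L -> K^o)); rewrite lfunE /=.
    by rewrite (coord_free 0 0) // seq1_free oner_neq0.
  exists 1%AS, s, 0%VS; split; first exact: dimv1.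
  split; rewrite ?sub0v ?dimv1 //.
  - by move=> y; rewrite memv0 => /eqP ->; rewrite linear0.
  - by move=> y z; rewrite memv0 => /eqP -> _; rewrite mul0r linear0.
have le_good n : good n -> (n <= \dim {:L})%N.
  by move=> /asboolP[F [_ [_ [<- _]]]]; rewrite dimvS ?subvf.
case: (ex_maxnP ex_good le_good) => n /asboolP[F [s [N [dimF sNF]]]] maxn.
have [fullF|] := pselect (forall x, x \in F).
  exists s, N; rewrite (_ : {:L}%AS = F) //; apply/val_inj/eqP => /=.
  by rewrite eqEsubv subvf andbT; apply/subvP => x _; apply: fullF.
move=> /existsNP[x /negP xF].
have [|s' [N' sN']] := transfer_form_adjoin sNF xF.
  by apply: dvdn_odd odd_L; apply: (@field_dimS _ _ <<F; x>>%AS {:L}%AS); apply: subvf.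
have /maxn : good (\dim <<F; x>>) by apply/asboolP; exists <<F; x>>%AS, s', N'.
rewrite -dimF => le_dim; case/negP: xF.
have /eqP -> : F == <<F; x>>%VS :> {vspace L} by rewrite eqEdim subv_adjoin.
exact: memv_adjoin.
Qed.

(** The form is nondegenerate, since [s (y * y^-1)] is 1 for nonzero [y]. So the pairings of [X]
    with a basis form a matrix of full row rank, and a right inverse of it gives [w]. *)
Lemma dual_family s m (X : m.-tuple L) :
  s 1 = 1 -> free X -> exists w : 'I_m -> L, forall i j : 'I_m, s (X`_i * w j) = (i == j)%:R.
Proof.
move=> s1 freeX; pose e := vbasis {:L}.
pose A : 'M[K]_(m, \dim {:L}) := \matrix_(i, k) s (X`_i * e`_(k : nat)).
have /row_freeP[B AB] : row_free A.
  apply: inj_row_free => v vA0; pose y := \sum_i v 0 i *: X`_i.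
  have sye k : s (y * e`_k) = 0.
    have [lt_k|le_k] := ltnP k (\dim {:L}); last first.
      by rewrite nth_default ?mulr0 ?linear0 // size_tuple.
    have /matrixP/(_ 0 (Ordinal lt_k)) := vA0; rewrite !mxE => <-.
    rewrite mulr_suml linear_sum; apply: eq_bigr => i _.
    by rewrite mxE -scalerAl linearZ.
  have sy z : s (y * z) = 0.
    rewrite (coord_vbasis (memvf z)) mulr_sumr linear_sum big1 // => k _.
    by rewrite -scalerAr linearZ /= sye scaler0.
  have y0 : y = 0.
    apply: contra_eq (sy y^-1) => y_neq0.
    by rewrite divff // s1 oner_neq0.
  by apply/rowP => i; rewrite mxE; apply: (freeP freeX (v 0) y0).
exists (fun j => \sum_k B k j *: e`_k) => i j.
have /matrixP/(_ i j) := AB; rewrite !mxE => <-.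
rewrite mulr_sumr linear_sum; apply: eq_bigr => k _.
by rewrite mxE -scalerAr linearZ /= [RHS]mulrC.
Qed.

(** The basis consists of 1, a basis [v] of [N], and a totally isotropic family [u] dual to [v] and
    orthogonal to 1. The permutation [tau] exchanges [v] and [u] and fixes the index of 1. Making
    [u] isotropic requires dividing by 2. *)
Lemma transfer_basis_exists :
    2%N \notin [pchar K] -> odd (\dim {:L}) ->
  exists (s : 'Hom(L, K^o)) n (tau : 'I_n.+1 -> 'I_n.+1) (i0 : 'I_n.+1) (b : 'I_n.+1 -> L),
    [/\ involutive tau, forall i, (tau i == i) = (i == i0),
        forall i j, s (b i * b j) = (j == tau i)%:R &
        forall x, x = \sum_l s (x * b (tau l)) *: b l].
Proof.
move=> charK /transfer_form_exists[s [N [s1 sN sNN _ dimL]]].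
have two_neq0 : 2%:R != 0 :> K by apply: contra charK => two0; rewrite inE.
set m := \dim N in dimL; pose v := vbasis N.
have vN (i : 'I_m) : v`_i \in N by apply: vbasis_mem; rewrite mem_nth ?size_tuple.
have free1v : free (cons_tuple 1 v).
  rewrite free_cons (span_basis (vbasisP N)) (basis_free (vbasisP N)) andbT.
  by apply/negP => /sN; rewrite s1 => /eqP; rewrite oner_eq0.
(* Dualizing [v] together with 1 makes the vectors dual to [v] orthogonal to 1. *)
have [w wE] := dual_family s1 free1v.
pose w1 (j : 'I_m) := w (lift ord0 j).
have sw j : s (w1 j) = 0 by have := wE ord0 (lift ord0 j); rewrite mul1r.
have svw (i j : 'I_m) : s (v`_i * w1 j) = (i == j)%:R.
  by have := wE (lift ord0 i) (lift ord0 j); rewrite (inj_eq lift_inj).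
have svv (i j : 'I_m) : s (v`_i * v`_j) = 0 by rewrite sNN.
have sv (i : 'I_m) : s v`_i = 0 by rewrite sN.
(* This correction of the dual family makes it totally isotropic. *)
pose u (j : 'I_m) := w1 j - 2%:R^-1 *: \sum_k s (w1 j * w1 k) *: v`_k.
have svu (i j : 'I_m) : s (v`_i * u j) = (i == j)%:R.
  rewrite /u mulrBr linearB /= svw -scalerAr linearZ mulr_sumr linear_sum big1 /=.
    by rewrite scaler0 subr0.
  by move=> k _; rewrite -scalerAr linearZ /= svv scaler0.
have su j : s (u j) = 0.
  rewrite /u linearB /= sw linearZ /= linear_sum big1 /= ?scaler0 ?subr0 //.
  by move=> k _; rewrite linearZ /= sv scaler0.
have swu i j : s (w1 i * u j) = 2%:R^-1 * s (w1 i * w1 j).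
  have half2 : 1 - 2%:R^-1 = 2%:R^-1 :> K.
    by apply: (mulfI two_neq0); rewrite mulrBr mulr1 divff // mulr2n addrK.
  rewrite /u mulrBr linearB /= -scalerAr linearZ mulr_sumr linear_sum /=.
  rewrite (bigD1 i) //= big1 => [|k ki]; last first.
    rewrite -scalerAr linearZ /= [w1 i * _]mulrC svw (negPf ki).
    exact: scaler0.
  rewrite addr0 -scalerAr linearZ /= linearZ /= [w1 i * v`_i]mulrC svw eqxx (mulrC (w1 j)).
  move: (s _) => c; rewrite -[in RHS]half2 mulrBl mul1r.
  by rewrite -[c *: _]/(c * 1) mulr1 scalerN.
have suu i j : s (u i * u j) = 0.
  rewrite {1}/u mulrBl linearB /= swu -scalerAl linearZ mulr_suml linear_sum /=.
  rewrite (bigD1 j) //= big1 => [|k kj]; last first.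
    rewrite -scalerAl linearZ /= svu (negPf kj).
    exact: scaler0.
  rewrite addr0 -scalerAl linearZ /= linearZ /= svu eqxx.
  by rewrite -[_ *: true%:R]/(_ * 1) mulr1 scalerN subrr.
pose T : finType := option ('I_m + 'I_m).
pose tauT (t : T) : T := match t with
  | None => None | Some (inl i) => Some (inr i) | Some (inr i) => Some (inl i) end.
pose bT (t : T) : L := match t with
  | None => 1 | Some (inl i) => v`_i | Some (inr i) => u i end.
have sbT t t' : s (bT t * bT t') = (t' == tauT t)%:R.
  case: t t' => [[i|i]|] [[j|j]|] //=.
  - by rewrite svu eq_sym.
  - by rewrite mulr1 sv.
  - by rewrite mulrC svu.
  - by rewrite mulr1 su.
  - by rewrite mul1r sv.
  - by rewrite mul1r su.
  - by rewrite mul1r s1.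
have [n [g [g' [gK g'K cardn]]]] : exists n (g : 'I_n.+1 -> T) (g' : T -> 'I_n.+1),
    [/\ cancel g g', cancel g' g & n.+1 = m.*2.+1].
  have cardT : #|T| = m.*2.+1 by rewrite card_option card_sum card_ord addnn.
  exists m.*2, (fun i => enum_val (cast_ord (esym cardT) i)), (fun t => cast_ord cardT (enum_rank t)).
  by split=> // [i|t]; rewrite ?enum_valK ?cast_ordKV ?cast_ordK ?enum_rankK.
pose tau i := g' (tauT (g i)); pose b i := bT (g i).
have tauTK : involutive tauT by case=> [[]|].
have tauK : involutive tau by move=> i; rewrite /tau g'K tauTK gK.
have sb i j : s (b i * b j) = (j == tau i)%:R.
  by rewrite /b sbT -(can_eq gK) /tau g'K.
have coefE (c : 'I_n.+1 -> K) j : s ((\sum_l c l *: b l) * b (tau j)) = c j.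
  rewrite mulr_suml linear_sum (bigD1 j) //= big1 => [|l lj].
    by rewrite addr0 -scalerAl linearZ /= sb eqxx; apply: mulr1.
  rewrite -scalerAl linearZ /= sb (inj_eq (can_inj tauK)) eq_sym (negPf lj).
  exact: mulr0.
(* Duality gives freeness, and the bound on the dimension of [L] makes the family long enough to
   span. *)
have basis_b : basis_of {:L} [tuple b l | l < n.+1].
  have le_dim : (\dim {:L} <= n.+1)%N by rewrite cardn.
  rewrite basisEfree subvf size_tuple le_dim !andbT.
  apply/freeP => c c0 i; rewrite -(coefE c).
  rewrite (_ : \sum_l c l *: b l = 0) ?mul0r ?linear0 // -[RHS]c0.
  by apply: eq_bigr => l _; rewrite -tnth_nth tnth_mktuple.
exists s, n, tau, (g' None), b; split=> // [i|x].
  by rewrite -(can_eq gK) /tau g'K -(can2_eq gK g'K); case: (g i) => [[]|].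
have := coord_basis basis_b (memvf x); set c := coord _.
move=> xE; have {}xE : x = \sum_l c l x *: b l.
  by rewrite [LHS]xE; apply: eq_bigr => l _; rewrite -tnth_nth tnth_mktuple.
by rewrite [LHS]xE; apply: eq_bigr => l _; rewrite [in RHS]xE coefE.
Qed.

End TransferForm.

Local Open Scope kcat_scope.

(** * The ring with involution attached to a system *)

Section CategoryTheory.
Variables (K : comNzRingType) (C : kcategory K).
Implicit Types (A B D : C) (h : hermitian_structure C).

Lemma kcompDl A B D (f : khom A B) : {morph (fun g : khom B D => g \oc f) : x y / x + y}.
Proof. exact: (GRing.semilinear_linear ((@kcomp_bilinear K C A B D).1 f)).2. Qed.

Lemma kcompDr A B D (g : khom B D) : {morph (fun f : khom A B => g \oc f) : x y / x + y}.
Proof. exact: (GRing.semilinear_linear ((@kcomp_bilinear K C A B D).2 g)).2. Qed.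

Lemma kcompZl A B D a (g : khom B D) (f : khom A B) : (a *: g) \oc f = a *: (g \oc f).
Proof. exact: (GRing.semilinear_linear ((@kcomp_bilinear K C A B D).1 f)).1. Qed.

Lemma kcompZr A B D a (g : khom B D) (f : khom A B) : g \oc (a *: f) = a *: (g \oc f).
Proof. exact: (GRing.semilinear_linear ((@kcomp_bilinear K C A B D).2 g)).1. Qed.

Lemma kcomp0l A B D (f : khom A B) : (0 : khom B D) \oc f = 0.
Proof. by rewrite -(scale0r 0) kcompZl scale0r. Qed.

Lemma kcomp0r A B D (g : khom B D) : g \oc (0 : khom A B) = 0.
Proof. by rewrite -(scale0r 0) kcompZr scale0r. Qed.

Lemma kcompNl A B D (g : khom B D) (f : khom A B) : (- g) \oc f = - (g \oc f).
Proof. by rewrite -scaleN1r kcompZl scaleN1r. Qed.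

Lemma kcompNr A B D (g : khom B D) (f : khom A B) : g \oc (- f) = - (g \oc f).
Proof. by rewrite -scaleN1r kcompZr scaleN1r. Qed.

Lemma kcomp_suml A B D (f : khom A B) (J : Type) (r : seq J) (g : J -> khom B D) :
  (\sum_(j <- r) g j) \oc f = \sum_(j <- r) (g j \oc f).
Proof. exact: (big_morph (fun x : khom B D => x \oc f) (kcompDl f) (kcomp0l _ f)). Qed.

Lemma kcomp_sumr A B D (g : khom B D) (J : Type) (r : seq J) (f : J -> khom A B) :
  g \oc (\sum_(j <- r) f j) = \sum_(j <- r) (g \oc f j).
Proof. exact: (big_morph (fun x : khom A B => g \oc x) (kcompDr g) (kcomp0r _ g)). Qed.

Lemma hdualmD h A B : {morph @hdualm K C h A B : x y / x + y}.
Proof. exact: (GRing.semilinear_linear (@hdualm_linear K C h A B)).2. Qed.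

Lemma hdualmZ h A B a (f : khom A B) : hdualm h (a *: f) = a *: hdualm h f.
Proof. exact: (GRing.semilinear_linear (@hdualm_linear K C h A B)).1. Qed.

Lemma hdualmN h A B (f : khom A B) : hdualm h (- f) = - hdualm h f.
Proof. by rewrite -scaleN1r hdualmZ scaleN1r. Qed.

Lemma hdualm0 h A B : hdualm h (0 : khom A B) = 0.
Proof. by rewrite -(scale0r 0) hdualmZ scale0r. Qed.

Definition endo A : Type := khom A A.
HB.instance Definition _ A := GRing.Lmodule.on (endo A).

Fact endo_mulDl A : left_distributive (kcomp : endo A -> endo A -> endo A) +%R.
Proof. by move=> x y z; exact: kcompDl. Qed.

Fact endo_mulDr A : right_distributive (kcomp : endo A -> endo A -> endo A) +%R.
Proof. by move=> x y z; exact: kcompDr. Qed.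

HB.instance Definition _ A := GRing.Zmodule_isPzRing.Build (endo A)
  (@kcompA K C A A A A) (@kcomp1m K C A A) (@kcompm1 K C A A) (@endo_mulDl A) (@endo_mulDr A).

Variables (I : Type) (H : I -> hermitian_structure C).

(* An isometry f is encoded by the pair (f, f^-1).  Dropping invertibility,    *)
(* the endomorphisms of S become the pairs (f, g) with s f = g^* s and         *)
(* s g = f^* s, which form a ring with involution (f, g) |-> (g, f).           *)
Definition adjoint_pair (S : sesq_system H)
    (x : (endo (carrier S) * (endo (carrier S))^c)%type) : bool :=
  `[< forall i, sform S i \oc (x.1 : khom _ _) = hdualm (H i) (x.2 : khom _ _) \oc sform S i /\
                sform S i \oc (x.2 : khom _ _) = hdualm (H i) (x.1 : khom _ _) \oc sform S i >].

Fact adjoint_pair_closed (S : sesq_system H) : subring_closed (@adjoint_pair S).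
Proof.
split=> [|x y /asboolP Sx /asboolP Sy|x y /asboolP Sx /asboolP Sy]; apply/asboolP => i /=.
- have -> : (1 : endo (carrier S)) = kid (carrier S) by [].
  have -> : (1 : (endo (carrier S))^c) = kid (carrier S) by [].
  by rewrite kcompm1 hdualm_id kcomp1m.
- have [Sx1 Sx2] := Sx i; have [Sy1 Sy2] := Sy i; split.
    rewrite [LHS]kcompDr [X in _ = X \oc _]hdualmD kcompDl Sx1; congr (_ + _).
    by rewrite [LHS]kcompNr [X in _ = X \oc _]hdualmN kcompNl Sy1.
  rewrite [LHS]kcompDr [X in _ = X \oc _]hdualmD kcompDl Sx2; congr (_ + _).
  by rewrite [LHS]kcompNr [X in _ = X \oc _]hdualmN kcompNl Sy2.
- have [Sx1 Sx2] := Sx i; have [Sy1 Sy2] := Sy i; split.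
    by rewrite [LHS]kcompA Sx1 -kcompA Sy1 kcompA -hdualm_comp.
  by rewrite [LHS]kcompA Sy2 -kcompA Sx2 kcompA -hdualm_comp.
Qed.

Record adj (S : sesq_system H) := Adj {
  adj_val :> (endo (carrier S) * (endo (carrier S))^c)%type;
  adj_valP : @adjoint_pair S adj_val
}.

HB.instance Definition _ (S : sesq_system H) := [isSub for @adj_val S].
HB.instance Definition _ (S : sesq_system H) := [Choice of adj S by <:].
HB.instance Definition _ (S : sesq_system H) :=
  GRing.SubChoice_isSubPzRing.Build _ _ (adj S) (@adjoint_pair_closed S).

Fact adj_swapP S (x : adj S) : @adjoint_pair S ((x : _ * _).2, (x : _ * _).1).
Proof. by apply/asboolP => i /=; have /asboolP/(_ i)[] := adj_valP x. Qed.

Definition adj_swap S (x : adj S) : adj S := Adj (adj_swapP x).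

Lemma adj_swap_involution S : involution (@adj_swap S).
Proof. by split=> [x y|x y|x]; apply: val_inj => //; case: x => -[]. Qed.

End CategoryTheory.

Lemma finite_over_adj (K : fieldType) (C : kcategory K) (I : Type)
    (H : I -> hermitian_structure C) (S : sesq_system H) :
  finite_dim (khom (carrier S) (carrier S)) -> finite_over K (adj S).
Proof.
move=> [n [[v2r lin_v2r [r2v v2rK _]]]].
have v2rD x y : v2r (x + y) = v2r x + v2r y.
  exact: (GRing.semilinear_linear lin_v2r).2.
have v2rZ a x : v2r (a *: x) = a *: v2r x.
  exact: (GRing.semilinear_linear lin_v2r).1.
pose T := carrier S.
(* The pair of [k] times the identity is adjoint because the dualities are [K]-linear. *)
have cP k : @adjoint_pair K C I H S (k *: kid T : endo T, k *: kid T : endo T).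
  by apply/asboolP => i /=; rewrite kcompZr hdualmZ hdualm_id kcompZl kcompm1 kcomp1m.
pose iota (x : adj S) : 'rV[K]_n * 'rV[K]_n := (v2r (val x).1, v2r (val x).2).
have iotaB : zmod_morphism iota.
  move=> x y; rewrite /iota /=; congr (_, _).
    by rewrite v2rD -scaleN1r v2rZ scaleN1r.
  by rewrite [LHS]v2rD -scaleN1r v2rZ scaleN1r.
pose F := HB.pack_for {additive adj S -> ('rV[K]_n * 'rV[K]_n)%type} iota
  (GRing.isZmodMorphism.Build _ _ iota iotaB).
exists ('rV[K]_n * 'rV[K]_n)%type, F, (fun k => Adj (cP k)); split=> [x y|k x|k x].
- move=> [/(can_inj v2rK) eq1 /(can_inj v2rK) eq2]; apply: val_inj.
  by rewrite (surjective_pairing (val x)) eq1 eq2 -surjective_pairing.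
- congr (_, _); rewrite /= -v2rZ; congr v2r.
    by rewrite [LHS]kcompZr kcompm1.
  by rewrite [LHS]kcompZl kcomp1m.
- apply: val_inj; congr (_, _) => /=.
    by rewrite [LHS]kcompZl [RHS]kcompZr kcomp1m kcompm1.
  by rewrite [LHS]kcompZr [RHS]kcompZl kcomp1m kcompm1.
Qed.

(** * Morphisms over L as matrices of morphisms over K *)

Section Contraction.
Variables (K : fieldType) (L : fieldExtType K) (s : 'Hom(L, K^o)).
Implicit Types (d : L).

Definition contract (V : lmodType K) d (x : ext L V) : V :=
  tlift (fun (v : V) (a : L) => (s (d * a) : K) *: v) x.

Fact contract_bilinear (V : lmodType K) d :
  bilinear_for *:%R *:%R (fun (v : V) (a : L) => (s (d * a) : K) *: v).
Proof.
split=> [a|v] k x y.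
  rewrite /= scalerDr !scalerA; congr (_ *: _ + _); exact: mulrC.
by rewrite /= mulrDr -scalerAr linearP scalerDl; congr (_ + _); rewrite [RHS]scalerA.
Qed.

Lemma contract_tens (V : lmodType K) d (v : V) a :
  contract d (etens v a) = (s (d * a) : K) *: v.
Proof. exact: (tlift_tens _ _ (contract_bilinear V d)). Qed.

Lemma contractD (V : lmodType K) d : {morph @contract V d : x y / x + y}.
Proof. exact: (GRing.semilinear_linear (tlift_linear (contract_bilinear V d))).2. Qed.

Variable C : kcategory K.
Implicit Types A B D : C.

Lemma ext_comp_tens A B D (g : khom B D) (f : khom A B) (a b : L) :
  ext_comp (etens g a) (etens f b) = etens (g \oc f) (a * b).
Proof. exact: ext_map2_tens (@kcomp_bilinear K C A B D) _ _ _ _. Qed.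

Lemma ext_compDl A B D (f : ext L (khom A B)) :
  {morph (fun g : ext L (khom B D) => ext_comp g f) : x y / x + y}.
Proof. exact: ext_map2Dl (@kcomp_bilinear K C A B D) f. Qed.

Lemma ext_compDr A B D (g : ext L (khom B D)) :
  {morph (fun f : ext L (khom A B) => ext_comp g f) : x y / x + y}.
Proof. exact: ext_map2Dr (@kcomp_bilinear K C A B D) g. Qed.

Lemma contract_compl A B D d (g : khom B D) (f : ext L (khom A B)) :
  contract d (ext_comp (etens g 1) f) = g \oc contract d f.
Proof.
move: f; apply: ext_eq => [x y|x y|f a].
- by rewrite ext_compDr contractD.
- by rewrite contractD kcompDr.
- by rewrite ext_comp_tens !contract_tens mul1r kcompZr.
Qed.

Lemma contract_compr A B D d (g : ext L (khom B D)) (f : khom A B) :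
  contract d (ext_comp g (etens f 1)) = contract d g \oc f.
Proof.
move: g; apply: ext_eq => [x y|x y|g a].
- by rewrite ext_compDl contractD.
- by rewrite contractD kcompDl.
- by rewrite ext_comp_tens !contract_tens mulr1 kcompZl.
Qed.

Lemma contract_dualm A B d (h : hermitian_structure C) (f : ext L (khom A B)) :
  contract d (ext_dualm h f) = hdualm h (contract d f).
Proof.
move: f; apply: ext_eq => [x y|x y|f a].
- by rewrite /ext_dualm (ext_mapD (@hdualm_linear K C h A B)) contractD.
- by rewrite contractD hdualmD.
- by rewrite /ext_dualm (ext_map_tens (@hdualm_linear K C h A B)) !contract_tens hdualmZ.
Qed.

Variables (n : nat) (tau : 'I_n.+1 -> 'I_n.+1) (b : 'I_n.+1 -> L).
Hypothesis bE : forall x, x = \sum_l s (x * b (tau l)) *: b l.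

(* f acts on L-points; this is its matrix with respect to the basis b of L.    *)
Definition mx_coef (V : lmodType K) (f : ext L V) (j i : 'I_n.+1) : V :=
  contract (b i * b (tau j)) f.

(** On pure tensors this is the expansion of [b i * c] in the basis [b], where [c] is the scalar of
    [f]. *)
Lemma mx_coef_comp A B D (g : ext L (khom B D)) (f : ext L (khom A B)) j i :
  mx_coef (ext_comp g f) j i = \sum_l mx_coef g j l \oc mx_coef f l i.
Proof.
move: g; apply: ext_eq => [x y|x y|g a].
- by rewrite /mx_coef ext_compDl contractD.
- by rewrite /mx_coef -big_split; apply: eq_bigr => l _; rewrite contractD kcompDl.
move: f; apply: ext_eq => [x y|x y|f c].
- by rewrite /mx_coef ext_compDr contractD.
- by rewrite /mx_coef -big_split; apply: eq_bigr => l _; rewrite contractD kcompDr.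
rewrite /mx_coef ext_comp_tens contract_tens.
transitivity ((\sum_l s (b l * b (tau j) * a) * s (b i * b (tau l) * c)) *: (g \oc f)).
  congr (_ *: _); rewrite (_ : b i * b (tau j) * (a * c) = (b i * c) * (b (tau j) * a)).
    rewrite {1}(bE (b i * c)) mulr_suml linear_sum; apply: eq_bigr => l _.
    rewrite -scalerAl linearZ /= mulrA (mulrAC (b i) c).
    exact: mulrC.
  by rewrite [a * c]mulrC mulrACA.
rewrite scaler_suml; apply: eq_bigr => l _.
by rewrite !contract_tens kcompZl kcompZr scalerA.
Qed.

End Contraction.

(** * The orthogonal sum of two systems and its projections *)

Section OrthogonalSum.
Variables (K : comNzRingType) (C : kcategory K) (I : Type).
Variables (H : I -> hermitian_structure C) (S S' : sesq_system H).
Local Notation M := (carrier S).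
Local Notation M' := (carrier S').
Variables (T : C) (i : khom M T) (j : khom M' T) (p : khom T M) (q : khom T M').
Hypotheses (pi : p \oc i = kid M) (qj : q \oc j = kid M').
Hypotheses (pj : p \oc j = 0) (qi : q \oc i = 0).

Definition sum_sform k : khom T (hdual (H k) T) :=
  hdualm (H k) p \oc sform S k \oc p + hdualm (H k) q \oc sform S' k \oc q.

Definition sum_system : sesq_system H := @SesqSystem K C I H T sum_sform.

Lemma sum_sform_i k A (f : khom A M) :
  sum_sform k \oc (i \oc f) = hdualm (H k) p \oc sform S k \oc f.
Proof.
by rewrite kcompA kcompDl -!(kcompA _ _ i) pi qi kcompm1 kcomp0r addr0.
Qed.

Lemma sum_sform_j k A (f : khom A M') :
  sum_sform k \oc (j \oc f) = hdualm (H k) q \oc sform S' k \oc f.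
Proof.
by rewrite kcompA kcompDl -!(kcompA _ _ j) pj qj kcompm1 kcomp0r add0r.
Qed.

Lemma dual_i_sum_sform k : hdualm (H k) i \oc sum_sform k = sform S k \oc p.
Proof.
rewrite kcompDr !kcompA -!hdualm_comp pi qi hdualm_id hdualm0 kcomp1m.
by rewrite !kcomp0l addr0.
Qed.

Lemma dual_j_sum_sform k : hdualm (H k) j \oc sum_sform k = sform S' k \oc q.
Proof.
rewrite kcompDr !kcompA -!hdualm_comp pj qj hdualm_id hdualm0 kcomp1m.
by rewrite !kcomp0l add0r.
Qed.

Fact adj_idl_subproof : @adjoint_pair K C I H sum_system (i \oc p, i \oc p).
Proof.
by apply/asboolP => k /=; rewrite sum_sform_i hdualm_comp -(kcompA _ _ (sum_sform k))
  dual_i_sum_sform kcompA.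
Qed.

Fact adj_idr_subproof : @adjoint_pair K C I H sum_system (j \oc q, j \oc q).
Proof.
by apply/asboolP => k /=; rewrite sum_sform_j hdualm_comp -(kcompA _ _ (sum_sform k))
  dual_j_sum_sform kcompA.
Qed.

Definition adj_idl : adj sum_system := Adj adj_idl_subproof.
Definition adj_idr : adj sum_system := Adj adj_idr_subproof.

Fact adj_hom_subproof (f : khom M M') (g : khom M' M) :
  (forall k, sform S' k \oc f = hdualm (H k) g \oc sform S k) ->
  (forall k, sform S k \oc g = hdualm (H k) f \oc sform S' k) ->
  @adjoint_pair K C I H sum_system (j \oc f \oc p, i \oc g \oc q).
Proof.
move=> fg gf; apply/asboolP => k /=; split.
  rewrite -[j \oc f \oc p]kcompA sum_sform_j !hdualm_comp -!(kcompA _ _ (sum_sform k)).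
  by rewrite dual_i_sum_sform -!kcompA (kcompA _ f) fg !kcompA.
rewrite -[i \oc g \oc q]kcompA sum_sform_i !hdualm_comp -!(kcompA _ _ (sum_sform k)).
by rewrite dual_j_sum_sform -!kcompA (kcompA _ g) gf !kcompA.
Qed.

(** For a unitary pair [(a, b)], the composites [b \oc a] and [a \oc b] are the projections to M and
    M'. So [a] restricts to an isomorphism from M to M' with inverse induced by [b], and the
    adjointness of [a] and [b] turns into compatibility with the forms. *)
Lemma isometric_of_unitary_equiv :
  unitary_equiv (@adj_swap K C I H sum_system) adj_idl adj_idr -> isometric S S'.
Proof.
move=> [x [xx xx' _ _]]; pose a : khom T T := (val x).1; pose b : khom T T := (val x).2.
have ba : b \oc a = i \oc p by exact: (congr1 (fun y => (val y).1) xx).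
have ab : a \oc b = j \oc q by exact: (congr1 (fun y => (val y).1) xx').
have Sx k : sum_sform k \oc a = hdualm (H k) b \oc sum_sform k.
  by have /asboolP/(_ k)[] := valP x.
have aip : a \oc (i \oc p) = j \oc q \oc a by rewrite -ba kcompA ab.
have ai : a \oc i = j \oc (q \oc a \oc i).
  by rewrite !kcompA -aip -!kcompA pi kcompm1.
have bj : b \oc j = i \oc (p \oc b \oc j).
  have bjq : b \oc (j \oc q) = i \oc p \oc b by rewrite -ab kcompA ba.
  by rewrite !kcompA -bjq -!kcompA qj kcompm1.
exists (q \oc a \oc i); split.
  exists (p \oc b \oc j); split.
    have -> : p \oc b \oc j \oc (q \oc a \oc i) = p \oc b \oc (j \oc (q \oc a \oc i)).
      by rewrite !kcompA.
    by rewrite -ai -kcompA (kcompA b) ba -kcompA pi kcompm1.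
  have -> : q \oc a \oc i \oc (p \oc b \oc j) = q \oc a \oc (i \oc (p \oc b \oc j)).
    by rewrite !kcompA.
  by rewrite -bj -kcompA (kcompA a) ab -kcompA qj kcompm1.
move=> k; rewrite [in X in X \oc _ \oc _]hdualm_comp hdualm_comp.
set f := q \oc a \oc i; rewrite -!kcompA (kcompA (sform S' k)) [X in _ \oc (_ \oc X)](_ : _ =
  sum_sform k \oc (a \oc i)); last first.
  by rewrite ai sum_sform_j !kcompA.
rewrite (kcompA _ a) Sx !kcompA -(kcompA _ _ (hdualm (H k) b)) -hdualm_comp ba hdualm_comp.
rewrite -[X in X \oc i](kcompA) -(kcompA _ _ (sum_sform k)) dual_i_sum_sform.
by rewrite !kcompA -hdualm_comp pi hdualm_id kcomp1m -kcompA pi kcompm1.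
Qed.

End OrthogonalSum.

Lemma isometric_base_change (K : fieldType) (L : fieldExtType K) (C : kcategory K)
    (I : Type) (H : I -> hermitian_structure C) (S S' : sesq_system H) :
  isometric S S' -> isometric (base_change L S) (base_change L S').
Proof.
move=> [f [[g [gf fg]] fE]]; exists (etens f 1); split.
  exists (etens g 1); split.
    by rewrite [LHS]ext_comp_tens gf mulr1.
  by rewrite [LHS]ext_comp_tens fg mulr1.
move=> k; rewrite -[in RHS]/(sform _ k) /=.
rewrite /ext_dualm (ext_map_tens (@hdualm_linear K C (H k) _ _)).
by rewrite !ext_comp_tens !mulr1 fE.
Qed.

Lemma isometry_adjoint (K : comNzRingType) (C : kcategory K) (h : hermitian_structure C)
    (A B : C) (s : khom A (hdual h A)) (s' : khom B (hdual h B)) (f : khom A B) (g : khom B A) :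
    g \oc f = kid A -> f \oc g = kid B -> hdualm h f \oc s' \oc f = s ->
  s' \oc f = hdualm h g \oc s /\ s \oc g = hdualm h f \oc s'.
Proof.
move=> gf fg <-; split; last by rewrite -!kcompA fg kcompm1.
by rewrite !kcompA -hdualm_comp fg hdualm_id kcomp1m.
Qed.

(** In a matrix fixed by [mx_sg], the second components are the first components of the entries
    reflected along [tau]. *)
Lemma adj_mx_eq (K : comNzRingType) (C : kcategory K) (I : Type)
    (H : I -> hermitian_structure C) (S : sesq_system H) n (tau : 'I_n.+1 -> 'I_n.+1)
    (X Y : 'M[adj S]_n.+1) :
    mx_sg (@adj_swap K C I H S) tau X = X -> mx_sg (@adj_swap K C I H S) tau Y = Y ->
    (forall l i, (val (X l i)).1 = (val (Y l i)).1) ->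
  X = Y.
Proof.
move=> sX sY XY; apply/matrixP => l i; apply: val_inj.
rewrite [LHS]surjective_pairing XY [RHS]surjective_pairing; congr (_, _).
by rewrite -sX -sY !mxE /=; apply: XY.
Qed.

(** * Transfer of an isometry from L to K *)

Section Descent.
Variables (K : fieldType) (L : fieldExtType K) (C : kcategory K) (I : Type).
Variables (H : I -> hermitian_structure C) (S S' : sesq_system H).
Local Notation M := (carrier S).
Local Notation M' := (carrier S').
Variables (T : C) (i : khom M T) (j : khom M' T) (p : khom T M) (q : khom T M').
Hypotheses (pi : p \oc i = kid M) (qj : q \oc j = kid M').
Hypotheses (pj : p \oc j = 0) (qi : q \oc i = 0).
Variables (s : 'Hom(L, K^o)) (n : nat) (tau : 'I_n.+1 -> 'I_n.+1) (b : 'I_n.+1 -> L).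
Hypothesis tauK : involutive tau.
Hypothesis bb : forall l k, s (b l * b k) = (k == tau l)%:R.
Hypothesis bE : forall x, x = \sum_l s (x * b (tau l)) *: b l.

Local Notation coef := (mx_coef s tau b).
Local Notation U := (@sum_system K C I H S S' T p q).
Local Notation idl := (@adj_idl K C I H S S' T i p q pi qi).
Local Notation idr := (@adj_idr K C I H S S' T j p q qj pj).

(** Multiplication by an element of [L] is self-adjoint for the form [s (x * y)]. Hence the adjoint
    of [transfer_mx] has the coefficients of [psi] where [transfer_mx] has those of [phi]. *)
Lemma mx_coef_tau (V : lmodType K) (f : ext L V) l k : coef f (tau k) (tau l) = coef f l k.
Proof. by rewrite /mx_coef tauK mulrC. Qed.

Lemma mx_coef_id (A : C) l k : coef (ext_id L A) l k = (kid A) *+ (l == k).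
Proof.
rewrite /mx_coef contract_tens mulr1 bb (inj_eq (can_inj tauK)).
by case: eqP => _; rewrite ?scale1r ?scale0r.
Qed.

Variables (phi : ext L (khom M M')) (psi : ext L (khom M' M)).
Hypotheses (psi_phi : ext_comp psi phi = ext_id L M) (phi_psi : ext_comp phi psi = ext_id L M').
Hypothesis phi_adj : forall k, ext_comp (etens (sform S' k) 1) phi =
  ext_comp (ext_dualm (H k) psi) (etens (sform S k) 1).
Hypothesis psi_adj : forall k, ext_comp (etens (sform S k) 1) psi =
  ext_comp (ext_dualm (H k) phi) (etens (sform S' k) 1).

Fact transfer_mx_subproof l k :
  @adjoint_pair K C I H U (j \oc coef phi l k \oc p, i \oc coef psi l k \oc q).
Proof.
apply: adj_hom_subproof => // m.
  by rewrite /mx_coef -contract_compl phi_adj contract_compr contract_dualm.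
by rewrite /mx_coef -contract_compl psi_adj contract_compr contract_dualm.
Qed.

Definition transfer_mx : 'M[adj U]_n.+1 := \matrix_(l, k) Adj (transfer_mx_subproof l k).

Let fst_sum (J : Type) (r : seq J) (F : J -> adj U) :
  (val (\sum_(l <- r) F l)).1 = \sum_(l <- r) (val (F l)).1.
Proof. exact: (big_morph (fun x : adj U => (val x).1)). Qed.

Let fst_mulrn (x : adj U) m : (val (x *+ m)).1 = (val x).1 *+ m.
Proof. by elim: m => [|m IHm]; rewrite ?mulr0n // !mulrS -IHm. Qed.

Let sgM := involution_mx_sg (@adj_swap_involution K C I H U) tauK.
Local Notation sg := (mx_sg (@adj_swap K C I H U) tau).

(** As [phi] and [psi] are mutually inverse, so are their coefficient matrices by [mx_coef_comp],
    and these are the first components of [transfer_mx] and of its adjoint. *)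
Lemma transfer_mx_unitary :
  unitary_equiv sg idl%:M idr%:M.
Proof.
have idl_sg : adj_swap idl = idl by apply: val_inj.
have idr_sg : adj_swap idr = idr by apply: val_inj.
have sgl := mx_sg_scalar (@adj_swap_involution K C I H U) tauK idl_sg.
have sgr := mx_sg_scalar (@adj_swap_involution K C I H U) tauK idr_sg.
exists transfer_mx; split.
- apply: adj_mx_eq (sgl) _; first by rewrite (invoM sgM) (invoK sgM).
  move=> l k; rewrite -mulmxE !mxE fst_sum fst_mulrn /=.
  transitivity (i \oc coef (ext_comp psi phi) l k \oc p).
    rewrite (mx_coef_comp bE) kcomp_sumr kcomp_suml; apply: eq_bigr => m _.
    rewrite !mxE /= mx_coef_tau [LHS]kcompA -(kcompA _ q) (kcompA q) qj kcomp1m.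
    by rewrite !kcompA.
  rewrite psi_phi mx_coef_id; case: eqP => _; rewrite ?mulr1n ?mulr0n ?kcompm1 //.
  by rewrite kcomp0r kcomp0l.
- apply: adj_mx_eq (sgr) _; first by rewrite (invoM sgM) (invoK sgM).
  move=> l k; rewrite -mulmxE !mxE fst_sum fst_mulrn /=.
  transitivity (j \oc coef (ext_comp phi psi) l k \oc q).
    rewrite (mx_coef_comp bE) kcomp_sumr kcomp_suml; apply: eq_bigr => m _.
    rewrite !mxE /= mx_coef_tau [LHS]kcompA -(kcompA _ p) (kcompA p) pi kcomp1m.
    by rewrite !kcompA.
  rewrite phi_psi mx_coef_id; case: eqP => _; rewrite ?mulr1n ?mulr0n ?kcompm1 //.
  by rewrite kcomp0r kcomp0l.
- apply/matrixP => l k; rewrite -sel_mx_predT mulmx_sel mulr1n mxE; apply: val_inj.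
  congr (_, _) => /=.
    by rewrite [LHS]kcompA -(kcompA _ p) pi kcompm1.
  by rewrite [LHS]kcompA [X in X \oc _]kcompA -(kcompA _ p) pi kcompm1.
- apply/matrixP => l k; rewrite -sel_mx_predT sel_mulmx mulr1n mxE; apply: val_inj.
  congr (_, _) => /=.
    by rewrite [LHS]kcompA [X in X \oc _]kcompA -(kcompA _ q) qj kcompm1.
  by rewrite [LHS]kcompA -(kcompA _ q) qj kcompm1.
Qed.

End Descent.

Theorem theorem5p15 (K : fieldType) (L : fieldExtType K)
    (oddLK : odd (\dim {: L})) (charK : 2%N \notin [pchar K])
    (C : kcategory K) (finHom : forall X Y : C, finite_dim (khom X Y))
    (I : Type) (neI : inhabited I) (H : I -> hermitian_structure C)
    (S S' : sesq_system H) :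
  isometric (base_change L S) (base_change L S') <-> isometric S S'.
Proof.
split; last exact: isometric_base_change.
move=> [phi [[psi [psi_phi phi_psi]] phiE]].
have [s [n [tau [i0 [b [tauK tau_fix bb bE]]]]]] := transfer_basis_exists charK oddLK.
have [T [i [j [p [q [pi qj pj qi _]]]]]] := biproducts (carrier S) (carrier S').
have adjP k := isometry_adjoint psi_phi phi_psi (phiE k).
have XU := transfer_mx_unitary pi qj pj qi tauK bb bE psi_phi phi_psi
  (fun k => (adjP k).1) (fun k => (adjP k).2).
apply: (isometric_of_unitary_equiv (pi := pi) (qj := qj) (pj := pj) (qi := qi)).
apply: (unitary_equiv_scalar_mx (finite_over_adj (finHom _ _)) (@adj_swap_involution _ _ _ _ _)
  tauK tau_fix _ _ _ _ XU); apply: val_inj => //; congr (_, _).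
- by rewrite [LHS]kcompA -(kcompA _ p) pi kcompm1.
- by rewrite [LHS]kcompA -(kcompA _ p) pi kcompm1.
- by rewrite [LHS]kcompA -(kcompA _ q) qj kcompm1.
- by rewrite [LHS]kcompA -(kcompA _ q) qj kcompm1.
Qed.
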